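(* Let $n\ge 1$ and let $d=(d_1,\dots,d_t)$ be an $n$-dimension vector. Then there is a polynomial $k_{n,d}(z)\in\mathbb{Z}[z]$ such that for every prime power $q$, the number of $\mathrm{P}_{n,d}(q)$-conjugacy classes in $\mathrm{GL}_n(q)$ equals $k_{n,d}(q)$.
   Context: For a prime power $q$, $\mathbb{F}_q$ is the field with $q$ elements and $\mathrm{GL}_n(q)$ the group of invertible $n\times n$ matrices over $\mathbb{F}_q$. An $n$-dimension vector is a tuple $d=(d_1,\dots,d_t)$ of positive integers with $d_i<d_{i+1}$ for all $i$ and $d_t=n$. $\mathrm{P}_{n,d}(q)$ denotes the parabolic subgroup of $\mathrm{GL}_n(q)$ stabilizing the standard flag $\{0\}\subset \mathbb{F}_q^{d_1}\subset\mathbb{F}_q^{d_2}\subset\cdots\subset\mathbb{F}_q^{d_t}=\mathbb{F}_q^n$ (where $\mathbb{F}_q^{d_i}$ is spanned by the first $d_i$ standard basis vectors); i.e. block upper triangular matrices with diagonal blocks of sizes $d_1,d_2-d_1,\dots,d_t-d_{t-1}$. The $\mathrm{P}_{n,d}(q)$-conjugacy classes in $\mathrm{GL}_n(q)$ are the orbits of $\mathrm{P}_{n,d}(q)$ acting on $\mathrm{GL}_n(q)$ by conjugation $g\cdot x=gxg^{-1}$. *)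

(* Defs.v *)
From HB Require Import structures.
From mathcomp Require Import all_boot all_order all_algebra all_fingroup.
Set Implicit Arguments. Unset Strict Implicit. Unset Printing Implicit Defensive.
Import GRing.Theory.
Local Open Scope ring_scope.

Definition dimvec (n : nat) (d : seq nat) : bool :=
  [&& d != [::], all (fun x => 0 < x)%N d, sorted ltn d & last 0%N d == n].

Definition GLset (F : finFieldType) (n : nat) : {set 'M[F]_n} :=
  [set g : 'M[F]_n | g \in unitmx].

(* P_{n,d}(F): invertible matrices stabilizing each F^{d_i} (span of the first
   d_i standard basis vectors, acting on column vectors): the entries in rows
   r >= d_i of columns j < d_i vanish, i.e. block upper triangular. *)
Definition parabolic (F : finFieldType) (n : nat) (d : seq nat) : {set 'M[F]_n} :=
  [set g : 'M[F]_n | (g \in unitmx) &&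
     [forall r : 'I_n, forall j : 'I_n,
        has (fun k => (j < k)%N && (k <= r)%N) d ==> (g r j == 0)]].

Definition conj_orbit (F : finFieldType) (n : nat) (P : {set 'M[F]_n})
  (x : 'M[F]_n) : {set 'M[F]_n} :=
  [set g *m x *m invmx g | g in P].

Definition num_parabolic_classes (F : finFieldType) (n : nat) (d : seq nat) : nat :=
  #|[set conj_orbit (parabolic F n d) x | x in GLset F n]|.

(* Main.v *)
(** Burnside's lemma rewrites the number of orbits of [P] on [GL_n] as the sum, over
    the conjugacy classes of [GL_n], of the number of flags with the dimensions of
    [d] that are fixed by a representative [g]. A class is an F[X]-module structure
    on F^n, hence a family of partitions indexed by the monic irreducible polynomials
    [p <> X], and a fixed flag is a chain of submodules. The number of submodules of
    a given type in a module of a given type is the product over [p] of Hall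
    polynomials evaluated at [q ^ deg p]: such a number is a quotient of counts of
    adapted generating tuples, whose denominator is a monic integral polynomial, so
    that it is an integral polynomial because it takes integer values at all primes.

    Recording the dimensions of the members of a chain in the exponents of a variable
    [y], the sum over all types of weight [n] becomes a coefficient of the Euler product
    [\prod_p C(q ^ deg p, y ^ deg p)] for one polynomial [C] in [Z[z][y]] with [C(z, 0) = 1].
    Modulo a power of [y], [C] is a product of factors [(1 - z ^ j y ^ k) ^ +-1], for which
    unique factorization in F[X] gives [\prod_p (1 - v ^ deg p) = (1 - q v) / (1 - v)];
    so the coefficients of the product are integral polynomials in [q]. *)
Require Import Defs.
From HB Require Import structures.
From mathcomp Require Import all_boot all_order all_algebra all_fingroup.
From mathcomp Require Import qpoly zify ring.
Set Implicit Arguments. Unset Strict Implicit. Unset Printing Implicit Defensive.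
Import Order.TTheory GRing.Theory Num.Theory.
Local Open Scope ring_scope.

(** * Submodules of finite modules over F[X] *)

Section FiniteModules.
Variables (F : finFieldType) (E : finLmodType {poly F}).
Implicit Types (W N : {set E}) (p a b c : {poly F}) (v x y : E) (k : nat).

(** No structure theorem for F[X]-modules is invoked. The type of [W] at [p] is read off the sizes
    of the layers [psoc p j W]. These sizes are known when a cyclic summand is adjoined, they govern
    the number of choices of an adapted generator, and a submodule whose layers are those of the
    whole module is the whole module; so counting adapted tuples also shows that they exist. The
    obstacle is uniformity in q: the number of irreducible polynomials, hence of families of local
    types, grows with q. For this reason the local factor is the same polynomial at every [p], which
    enters through its degree only, and everything is truncated modulo [y ^ N], so that finitely
    many [p] remain and the result has coefficients independent of the field. One coefficient has to
    select both the size of the matrices and all dimensions of the flag. The price of this packing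
    is that families of weight different from n, which come from no matrix of size n, also enter the
    product and must be excluded by degree bounds. *)

Definition submod W :=
  [&& 0 \in W, [forall x in W, forall y in W, x + y \in W],
   [forall x in W, 'X *: x \in W] & [forall c : F, forall x in W, c%:P *: x \in W]].

(** Stability under all polynomials is not a finite check; stability under ['X] and the constants
    is, and it implies the rest because they generate F[X]. *)
Lemma submodP W :
  reflect [/\ 0 \in W, {in W &, forall x y, x + y \in W}
              & forall a, {in W, forall x, a *: x \in W}] (submod W).
Proof.
apply: (iffP and4P) => [[W0 /'forall_in_forall_inP WD /'forall_in_idP WX WC]|[W0 WD WZ]].
  split=> // [x y Wx Wy|a]; first exact: WD.
  elim/poly_ind: a => [|a c IHa] x Wx; first by rewrite scale0r.
  rewrite scalerDl WD // -?scalerA; last by move/forallP/(_ c)/forall_inP: WC => ->.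
  by apply: IHa; apply: WX.
split=> //.
- by apply/forall_inP=> x Wx; apply/forall_inP=> y Wy; apply: WD.
- by apply/forall_inP=> x Wx; apply: WZ.
- by apply/forallP=> c; apply/forall_inP=> x Wx; apply: WZ.
Qed.

Lemma submod0 W : submod W -> 0 \in W. Proof. by case/submodP. Qed.
Lemma submodD W x y : submod W -> x \in W -> y \in W -> x + y \in W.
Proof. by case/submodP=> _ + _; apply. Qed.
Lemma submodZ W a x : submod W -> x \in W -> a *: x \in W.
Proof. by case/submodP=> _ _; apply. Qed.
Lemma submodN W x : submod W -> x \in W -> - x \in W.
Proof. by move=> sW Wx; rewrite -scaleN1r submodZ. Qed.
Lemma submodB W x y : submod W -> x \in W -> y \in W -> x - y \in W.
Proof. by move=> sW Wx Wy; rewrite submodD // submodN. Qed.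

Lemma submod_setT : submod setT.
Proof. by apply/submodP; split=> [|x y _ _|a x _]; rewrite inE. Qed.

Lemma submod_set0 : submod [set 0].
Proof.
apply/submodP; split=> [|x y|a x]; rewrite !inE // => /eqP->; last by rewrite scaler0.
by rewrite add0r.
Qed.

Definition pker p W := [set x in W | p *: x == 0].
(** The kernel of [p] in [p ^ k W]. For irreducible [p], its dimension over F[X]/(p) is the number
    of summands F[X]/(p^j) of [W] with j > k: the layers encode the conjugate of the partition of
    [W] at [p]. *)
Definition psoc p k W :=
  [set x in W | (p *: x == 0) && [exists w in W, x == p ^+ k *: w]].

Lemma pkerP p W x : reflect (x \in W /\ p *: x = 0) (x \in pker p W).
Proof. by rewrite inE; apply: (iffP andP)=> -[? /eqP]. Qed.

Lemma psocP p k W x :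
  reflect [/\ x \in W, p *: x = 0 & exists2 w, w \in W & x = p ^+ k *: w]
          (x \in psoc p k W).
Proof.
rewrite inE; apply: (iffP and3P) => [[Wx /eqP px /exists_inP[w Ww /eqP xE]]|].
  by split=> //; exists w.
move=> [Wx px [w Ww xE]]; split=> //; first exact/eqP.
by apply/exists_inP; exists w=> //; apply/eqP.
Qed.

Lemma submod_psoc p k W : submod W -> submod (psoc p k W).
Proof.
move=> sW; apply/submodP; split.
- by apply/psocP; split; rewrite ?submod0 ?scaler0 //; exists 0; rewrite ?submod0 ?scaler0.
- move=> x y /psocP[Wx px [w Ww xE]] /psocP[Wy py [z Wz yE]].
  apply/psocP; split; rewrite ?submodD // ?scalerDr ?px ?py ?addr0 //.
  by exists (w + z); rewrite ?submodD // scalerDr xE yE.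
- move=> a x /psocP[Wx px [w Ww xE]].
  apply/psocP; split; rewrite ?submodZ //.
    by rewrite scalerA mulrC -scalerA px scaler0.
  by exists (a *: w); rewrite ?submodZ // xE !scalerA mulrC.
Qed.

Lemma psoc_sub p k W : psoc p k W \subset W.
Proof. by apply/subsetP=> x /psocP[]. Qed.

Lemma psocS p k W N : W \subset N -> psoc p k W \subset psoc p k N.
Proof.
move=> /subsetP sWN; apply/subsetP=> x /psocP[Wx px [w Ww xE]].
by apply/psocP; split=> //; [exact: sWN | exists w => //; exact: sWN].
Qed.

Lemma psoc_leq p j k W : submod W -> (j <= k)%N -> psoc p k W \subset psoc p j W.
Proof.
move=> sW lejk; apply/subsetP=> x /psocP[Wx px [w Ww xE]].
apply/psocP; split=> //.
by exists (p ^+ (k - j) *: w); rewrite ?submodZ // xE scalerA -exprD subnKC.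
Qed.


(** Over each element of [N], the fibre of multiplication by [a] is a coset of [pker a W]. *)
Lemma card_preim_scale W N a : submod W ->
    (forall y, y \in N -> exists2 x, x \in W & y = a *: x) ->
  #|[set x in W | a *: x \in N]| = (#|N| * #|pker a W|)%N.
Proof.
move=> sW imN; rewrite -sum_nat_const -sum1_card.
rewrite (partition_big (fun x => a *: x) [in N]) => [|x] /=; last by rewrite inE => /andP[].
apply: eq_bigr => y Ny; have [x0 Wx0 yE] := imN y Ny.
rewrite sum1_card -[RHS](card_imset _ (addrI x0)).
apply: eq_card => x; rewrite unfold_in inE /=; apply/idP/imsetP.
  move=> /andP[/andP[Wx _] /eqP ax]; exists (x - x0); last by rewrite addrC subrK.
  by apply/pkerP; rewrite submodB // scalerBr ax -yE subrr.
move=> [z /pkerP[Wz az] ->]; rewrite submodD // scalerDr az addr0 -yE Ny.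
exact: eqxx.
Qed.

(** The submodules of F[X] v form a chain: if [p ^ j], with j < k, were the exact power of [p] in
    [c], then [c *: v] would generate [p ^ j *: v] by Bezout, and [p ^ k.-1 *: v] would lie in [N].
    Hence F[X] v is F[X]/(p^k) and meets [N] trivially. *)
Lemma cycle_dvd N v p k c : submod N -> irreducible_poly p ->
  p ^+ k *: v = 0 -> p ^+ k.-1 *: v \notin N -> c *: v \in N -> p ^+ k %| c.
Proof.
move=> sN irr_p pkv pk1v cv.
suff: forall j, (j <= k)%N -> p ^+ j %| c by apply.
elim=> [|j IHj] ltjk; first by rewrite expr0 dvd1p.
have /dvdpP[b cE] := IHj (ltnW ltjk).
have [/dvdpP[b' bE]|npb] := boolP (p %| b).
  by apply/dvdpP; exists b'; rewrite cE bE exprS mulrA.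
case/negP: pk1v.
have cop : coprimep (p ^+ k) b by rewrite coprimep_expl // irreducible_poly_coprime.
have /Bezout_eq1_coprimepP[[u1 u2] /= uE] := cop.
have -> : p ^+ k.-1 = (p ^+ (k.-1 - j) * u1 * p ^+ j) * p ^+ k + (p ^+ (k.-1 - j) * u2) * c.
  have -> : p ^+ k.-1 = p ^+ (k.-1 - j) * p ^+ j.
    by rewrite -exprD subnK // -ltnS prednK // (leq_ltn_trans _ ltjk).
  by rewrite cE -[LHS]mulr1 -uE; ring.
by rewrite scalerDl -scalerA pkv scaler0 add0r -scalerA submodZ.
Qed.

(* The submodule [N + F[X] v], for [D] at least the degree of a polynomial killing [v]. *)
Definition addc N v D : {set E} :=
  [set y.1 + (polyn y.2 : {poly F}) *: v | y in setX N [set: {poly_D F}]].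

Lemma addcP N v p k x : irreducible_poly p -> p ^+ k *: v = 0 ->
  reflect (exists2 n, n \in N & exists a, x = n + a *: v)
          (x \in addc N v ((size p).-1 * k)).
Proof.
move=> irr_p pkv; apply: (iffP imsetP) => [[[n a] /setXP[Nn _] ->]|[n Nn [a ->]]].
  by exists n => //; exists (polyn a).
(* Reducing [a] modulo [p ^+ k], of degree [(size p).-1 * k], does not change [a *: v]. *)
have sz : (size (a %% p ^+ k)%R <= (size p).-1 * k)%N.
  have pk0 : p ^+ k != 0 by rewrite expf_neq0 // irredp_neq0.
  have := ltn_modp a (p ^+ k); rewrite pk0 -size_exp => /leq_trans; rewrite -ltnS.
  by apply; rewrite prednK // size_poly_gt0.
exists (n, NPoly sz); first by rewrite !inE Nn.
by rewrite /= [in LHS](divp_eq a (p ^+ k)) scalerDl -scalerA pkv scaler0 add0r.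
Qed.

Lemma submod_addc N v p k : submod N -> irreducible_poly p -> p ^+ k *: v = 0 ->
  submod (addc N v ((size p).-1 * k)).
Proof.
move=> sN irr_p pkv; have P x := addcP N x irr_p pkv.
apply/submodP; split.
- by apply/P; exists 0; rewrite ?submod0 //; exists 0; rewrite scale0r addr0.
- move=> x y /P[n Nn [a ->]] /P[m Nm [b ->]]; apply/P.
  by exists (n + m); rewrite ?submodD //; exists (a + b); rewrite scalerDl addrACA.
- move=> c x /P[n Nn [a ->]]; apply/P.
  by exists (c *: n); rewrite ?submodZ //; exists (c * a); rewrite scalerDr scalerA.
Qed.

(** The sum is direct: by [cycle_dvd], two coefficients of [v] giving the same element differ by a
    multiple of [p ^ k], while both have smaller degree. *)
Lemma card_addc N v p k : submod N -> irreducible_poly p ->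
  p ^+ k *: v = 0 -> p ^+ k.-1 *: v \notin N ->
  #|addc N v ((size p).-1 * k)| = (#|N| * #|F| ^ ((size p).-1 * k))%N.
Proof.
move=> sN irr_p pkv pk1v; rewrite card_in_imset ?cardsX ?cardsT ?card_npoly //.
move=> [n a] [m b] /setXP[Nn _] /setXP[Nm _] /= /eqP.
rewrite -subr_eq0 opprD addrACA -scalerBl addr_eq0 => /eqP nm.
have /(cycle_dvd sN irr_p pkv pk1v) dv : (polyn a - polyn b) *: v \in N.
  by rewrite -[_ *: v]opprK -nm submodN // submodB.
have ab : polyn a = polyn b.
  apply/eqP; rewrite -subr_eq0; apply: contraTT dv => ab0.
  apply/negP=> /(dvdp_leq ab0); apply/negP; rewrite -ltnNge.
  have pk0 : p ^+ k != 0 by rewrite expf_neq0 // irredp_neq0.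
  rewrite -(prednK (_ : 0 < size (p ^+ k))%N) ?size_poly_gt0 // size_exp ltnS.
  by rewrite (leq_trans (size_polyD _ _)) // geq_max size_polyN !size_npoly.
move: nm; rewrite ab subrr scale0r oppr0 => /eqP; rewrite subr_eq0 => /eqP ->.
by congr (_, _); apply: val_inj.
Qed.

Lemma sub_addc N v p k : submod N -> irreducible_poly p -> p ^+ k *: v = 0 ->
  N \subset addc N v ((size p).-1 * k).
Proof.
move=> sN irr_p pkv; apply/subsetP=> x Nx; apply/(addcP _ _ irr_p pkv).
by exists x => //; exists 0; rewrite scale0r addr0.
Qed.

Lemma gen_addc N v p k : submod N -> irreducible_poly p -> p ^+ k *: v = 0 ->
  v \in addc N v ((size p).-1 * k).
Proof.
move=> sN irr_p pkv; apply/(addcP _ _ irr_p pkv).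
by exists 0; rewrite ?submod0 //; exists 1; rewrite scale1r add0r.
Qed.

(** * Socle layers after adjoining a cyclic summand *)

Section SocleAddCycle.
Variables (N : {set E}) (v : E) (p : {poly F}) (k : nat).
Hypotheses (sN : submod N) (irr_p : irreducible_poly p).
Hypotheses (pkv : p ^+ k *: v = 0) (pk1v : p ^+ k.-1 *: v \notin N).
Let N' := addc N v ((size p).-1 * k).
Let sN' : submod N' := submod_addc sN irr_p pkv.

Let k_gt0 : (0 < k)%N.
Proof. by case: k pkv pk1v => // ->; rewrite submod0. Qed.

(** Since [N'] is the direct sum of [N] and F[X] v, the kernel of [r] and the image of [r ^ j] are
    computed componentwise. *)
Lemma socle_addc_decomp r j n a : n \in N -> n + a *: v \in psoc r j N' ->
  [/\ n \in psoc r j N, r *: (a *: v) = 0 & exists b, a *: v = (r ^+ j * b) *: v].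
Proof.
move=> Nn /psocP[_]; rewrite scalerDr => rx [w /(addcP _ _ irr_p pkv)[m Nm [b ->]]].
rewrite scalerDr !scalerA => xE.
have split0 z c : z \in N -> z + c *: v = 0 -> z = 0 /\ c *: v = 0.
  move=> Nz zc; have cN : c *: v \in N.
    by rewrite -(addKr z (c *: v)) zc addr0 submodN.
  have /(cycle_dvd sN irr_p pkv pk1v)/dvdpP[c' cE] := cN.
  have cv0 : c *: v = 0 by rewrite cE -scalerA pkv scaler0.
  by move: zc; rewrite cv0 addr0.
have [||rn rav] := split0 (r *: n) (r * a); rewrite ?submodZ //.
  by rewrite -scalerA.
have [||nE avE] := split0 (n - r ^+ j *: m) (a - r ^+ j * b); rewrite ?submodB ?submodZ //.
  by rewrite scalerBl addrACA -opprD xE subrr.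
split; rewrite ?scalerA //; last first.
  by exists b; apply/eqP; rewrite -subr_eq0 -scalerBl avE.
apply/psocP; split=> //; exists m => //.
by apply/eqP; rewrite -subr_eq0 nE.
Qed.

(** In F[X]/(p^k) the kernel of [p] is generated by [p ^ k.-1] and lies in the image of [p ^ j] as
    soon as j < k, so the layer gains one copy of F[X]/(p). *)
Lemma psoc_addc_same j : (j < k)%N ->
  #|psoc p j N'| = (#|psoc p j N| * #|F| ^ (size p).-1)%N.
Proof.
move=> ltjk; set D := (size p).-1.
pose f (y : E * {poly_D F}) := y.1 + (p ^+ k.-1 * polyn y.2) *: v.
have -> : psoc p j N' = [set f y | y in setX (psoc p j N) [set: {poly_D F}]].
  apply/setP=> x; apply/idP/imsetP.
    move=> sx; have : x \in N' by case/psocP: sx.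
    move=> /(addcP _ _ irr_p pkv)[n Nn [a xE]]; rewrite xE in sx *.
    have [sn pav _] := socle_addc_decomp Nn sx.
    have : p ^+ k %| p * a.
      by apply: (cycle_dvd sN irr_p pkv pk1v); rewrite -scalerA pav submod0.
    rewrite -(prednK k_gt0) exprS dvdp_mul2l ?irredp_neq0 // => /dvdpP[c aE].
    have sz : (size (c %% p)%R <= D)%N.
      have := ltn_modp c p; rewrite (irredp_neq0 irr_p) => /leq_trans; rewrite -ltnS.
      by apply; rewrite prednK // size_poly_gt0 irredp_neq0.
    exists (n, NPoly sz); first by apply/setXP; split; rewrite ?in_setT.
    rewrite /f /= aE [in LHS](divp_eq c p) mulrDl scalerDl.
    have -> : (c %/ p * p * p ^+ k.-1) *: v = 0.
      by rewrite -mulrA -exprS prednK // -scalerA pkv scaler0.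
    by rewrite add0r mulrC.
  move=> [[n a] /setXP[/= sn _] ->]; apply: submodD; first exact: submod_psoc.
    by apply: (subsetP (psocS _ _ (sub_addc sN irr_p pkv))).
  apply/psocP; split.
  - by rewrite submodZ // gen_addc.
  - by rewrite scalerA mulrA -exprS prednK // mulrC -scalerA pkv scaler0.
  exists ((p ^+ (k.-1 - j) * polyn a) *: v); first by rewrite submodZ // gen_addc.
  by rewrite scalerA mulrA -exprD subnKC // -ltnS prednK.
rewrite card_in_imset ?cardsX ?cardsT ?card_npoly //.
move=> [n a] [m b] /setXP[/psocP[Nn _ _] _] /setXP[/psocP[Nm _ _] _] /=.
rewrite /f /= => /eqP.
rewrite -subr_eq0 opprD addrACA -scalerBl -mulrBr addr_eq0 => /eqP nm.
have : p ^+ k %| p ^+ k.-1 * (polyn a - polyn b).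
  apply: (cycle_dvd sN irr_p pkv pk1v).
  by rewrite -[_ *: v]opprK -nm submodN // submodB.
rewrite -[in p ^+ k](prednK k_gt0) exprSr dvdp_mul2l ?expf_neq0 ?irredp_neq0 // => dv.
have ab : polyn a = polyn b.
  apply/eqP; rewrite -subr_eq0; apply: contraTT dv => ab0.
  apply/negP=> /(dvdp_leq ab0); apply/negP; rewrite -ltnNge.
  rewrite -(prednK (_ : 0 < size p)%N) ?size_poly_gt0 ?irredp_neq0 // ltnS.
  by rewrite (leq_trans (size_polyD _ _)) // geq_max size_polyN !size_npoly.
move: nm; rewrite ab subrr mulr0 scale0r oppr0 => /eqP; rewrite subr_eq0 => /eqP ->.
by congr (_, _); apply: val_inj.
Qed.

(** Either [r] is associated to [p] and [p ^ j] already kills [v], or [r] is coprime to [p ^ k] and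
    acts injectively on F[X] v. *)
Lemma psoc_addc_other r j : irreducible_poly r -> ~~ ((r %= p) && (j < k)%N) ->
  psoc r j N' = psoc r j N.
Proof.
move=> irr_r nrp; apply/eqP; rewrite eqEsubset [X in _ && X]psocS ?sub_addc // andbT.
apply/subsetP=> x sx; have : x \in N' by case/psocP: sx.
move=> /(addcP _ _ irr_p pkv)[n Nn [a xE]]; rewrite xE in sx *.
have [sn rav [b avE]] := socle_addc_decomp Nn sx.
suff -> : a *: v = 0 by rewrite addr0.
move: nrp; rewrite negb_and; have [/eqpP[[c d] /= /andP[c0 d0] rp] /= |nrp _] := boolP (r %= p).
  rewrite -leqNgt => lekj.
  have pjv : p ^+ j *: v = 0 by rewrite -(subnK lekj) exprD -scalerA pkv scaler0.
  rewrite avE (_ : r = (c^-1 * d) *: p); last by rewrite -scalerA -rp scalerA mulVf // scale1r.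
  by rewrite exprZn -mul_polyC [_ * b]mulrC mulrA -scalerA pjv scaler0.
have cop : coprimep (p ^+ k) r.
  rewrite coprimep_expl // irreducible_poly_coprime //; apply/negP=> dv.
  have := irr_r p _ dv; rewrite neq_ltn; case: irr_p => -> _; rewrite orbT => /(_ isT).
  by rewrite eqp_sym (negPf nrp).
have : p ^+ k %| r * a.
  by apply: (cycle_dvd sN irr_p pkv pk1v); rewrite -scalerA rav submod0.
rewrite Gauss_dvdpr // => /dvdpP[c ->].
by rewrite -scalerA pkv scaler0.
Qed.

End SocleAddCycle.

End FiniteModules.

(** * Adapted tuples *)

Lemma card_tupleS (T : finType) n (Q : T -> n.-tuple T -> bool) :
  #|[set t : n.+1.-tuple T | Q (thead t) [tuple of behead t]]|
    = (\sum_t #|[set v | Q v t]|)%N.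
Proof.
rewrite -sum1_card (partition_big (fun t : n.+1.-tuple T => [tuple of behead t]) predT) //=.
apply: eq_bigr => t _; rewrite sum1_card -[RHS](card_imset _ (_ : injective (fun v => [tuple of v :: t]))).
  apply: eq_card => s; rewrite unfold_in inE /=; apply/andP/imsetP.
    case=> Qs /eqP ts; exists (thead s); first by rewrite inE -ts.
    by rewrite -ts {1}(tuple_eta s).
  case=> v; rewrite inE => Qv ->; rewrite theadE.
  by have -> : [tuple of behead [tuple of v :: t]] = t by apply: val_inj.
by move=> v w [].
Qed.

Section Adapted.
Variables (F : finFieldType) (E : finLmodType {poly F}).
Implicit Types (W N : {set E}) (p a b c : {poly F}) (v : E) (k : nat).
Implicit Types (L : seq ({poly F} * nat)) (vs : seq E).
Local Notation q := #|F|.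

Fixpoint gen L vs : {set E} :=
  match L, vs with
  | x :: L', v :: vs' => addc (gen L' vs') v ((size x.1).-1 * x.2)
  | _, _ => [set 0]
  end.

(* The head of the list is chosen last. Given [p ^ k v = 0], the condition that
   [p ^ (k - 1) v] avoids the span of the tail says that [F[X] v] is isomorphic to
   [F[X] / (p ^ k)] and meets that span trivially. *)
Fixpoint adp W L vs : bool :=
  match L, vs with
  | x :: L', v :: vs' => [&& adp W L' vs', v \in W, x.1 ^+ x.2 *: v == 0
                           & x.1 ^+ x.2.-1 *: v \notin gen L' vs']
  | [::], [::] => true
  | _, _ => false
  end.

Definition eldiv L :=
  all (fun x => [&& irreducibleb x.1, x.1 \is monic & (0 < x.2)%N]) L.
Definition weight L := (\sum_(x <- L) (size x.1).-1 * x.2)%N.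
Definition npart L p j := count (fun x => (x.1 == p) && (j < x.2)%N) L.

(** Sizes of layers make types of different modules comparable without choosing a decomposition. *)
Definition hastype W L := forall p j, irreducible_poly p -> p \is monic ->
  #|psoc p j W| = (q ^ ((size p).-1 * npart L p j))%N.

Lemma psoc_set0 p j : psoc p j [set 0 : E] = [set 0].
Proof.
apply/setP=> x; rewrite in_set1; apply/psocP/eqP => [[]|->]; first by rewrite inE => /eqP.
by split; rewrite ?inE ?scaler0 //; exists 0; rewrite ?inE ?scaler0.
Qed.

Lemma adp_gen W L vs : submod W -> eldiv L -> adp W L vs ->
  [/\ submod (gen L vs), gen L vs \subset W, #|gen L vs| = (q ^ weight L)%N
    & hastype (gen L vs) L].
Proof.
move=> sW; elim: L vs => [|[p k] L IHL] [|v vs] //=.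
  move=> _ _; rewrite /weight big_nil cards1; split=> //; first exact: submod_set0.
    by rewrite sub1set submod0.
  by move=> p j _ _; rewrite psoc_set0 cards1 muln0.
move=> /andP[/and3P[/irreducibleP irr_p mon_p k_gt0] eL] /and4P[aL Wv /eqP pkv pk1v].
have [sN sNW cN tN] := IHL _ eL aL; split.
- exact: submod_addc.
- apply/subsetP=> x /(addcP _ _ irr_p pkv)[n Nn [a ->]].
  by rewrite submodD ?submodZ // (subsetP sNW).
- by rewrite card_addc // cN /weight big_cons /= expnD mulnC.
move=> r j irr_r mon_r; rewrite /npart /=.
have [/andP[/eqP pr ltjk]|npr] := boolP ((p == r) && _).
  by subst r; rewrite psoc_addc_same // tN // -expnD mulnDr muln1 addnC.
rewrite psoc_addc_other // ?tN // ?add0n //.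
by rewrite eqp_monic // eq_sym.
Qed.

(** Multiplication by [p ^ j] maps the kernel of [p ^ j.+1] onto the layer [psoc p j W], with kernel
    that of [p ^ j]. *)
Lemma card_pker p m W : submod W ->
  #|pker (p ^+ m) W| = (\prod_(j < m) #|psoc p j W|)%N.
Proof.
move=> sW; elim: m => [|m IHm].
  rewrite big_ord0 expr0 -(cards1 (0 : E)); apply: eq_card => x.
  rewrite in_set1; apply/pkerP/eqP => [[_]|->]; rewrite ?scale1r ?scaler0 //.
  by rewrite submod0.
rewrite big_ord_recr /= -IHm mulnC -card_preim_scale //; last by move=> y /psocP[].
apply: eq_card => x; rewrite inE; apply/pkerP/andP.
  case=> Wx pmx; split=> //; apply/psocP; split; rewrite ?submodZ //.
    by rewrite scalerA -exprS.
  by exists x.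
by case=> Wx /psocP[_ + _]; rewrite scalerA -exprS.
Qed.

(* Exponents attached to the same [p] must increase from head to tail: only then is the
   number of choices for the head independent of the tail. *)
Definition ordered L := pairwise (fun x y => (x.1 == y.1) ==> (x.2 <= y.2)%N) L.

(** The factor of a head (p, k) counts the vectors [v] by their image [p ^ k.-1 *: v]. This image
    runs over the layer [k.-1] of a module of type [L0], minus the [p]-socle of the span of the
    tail; each image comes from as many [v] as [pker (p ^ k.-1)] has elements. *)
Fixpoint adpcount L L0 : int :=
  if L is x :: L' then
    (q ^ ((size x.1).-1 * \sum_(j < x.2.-1) npart L0 x.1 j))%N%:Z *
    ((q ^ ((size x.1).-1 * npart L0 x.1 x.2.-1))%N%:Z
      - (q ^ ((size x.1).-1 * npart L' x.1 0))%N%:Z)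
    * adpcount L' L0
  else 1.

Lemma card_adp W L L0 : submod W -> hastype W L0 -> eldiv L -> ordered L ->
  #|[set t : (size L).-tuple E | adp W L t]|%:Z = adpcount L L0.
Proof.
move=> sW tW; elim: L => [|[p k] L IHL] //=.
  by move=> _ _; rewrite (_ : [set t | _] = setT) ?cardsT ?card_tuple // -setP => t; rewrite !inE tuple0.
move=> /andP[/and3P[/irreducibleP irr_p mon_p k_gt0] eL] /andP[ord1 ordL].
pose Q v (t : (size L).-tuple E) := [&& adp W L t, v \in W, p ^+ k *: v == 0
                           & p ^+ k.-1 *: v \notin gen L t].
transitivity (#|[set t : (size L).+1.-tuple E | Q (thead t) [tuple of behead t]]|%:Z).
  by apply: (congr1 Posz); apply: eq_card => t; rewrite !inE {1}(tuple_eta t).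
have H (t : (size L).-tuple E) : adp W L t -> #|[set v | Q v t]|%:Z =
    (q ^ ((size p).-1 * \sum_(j < k.-1) npart L0 p j))%N%:Z *
    ((q ^ ((size p).-1 * npart L0 p k.-1))%N%:Z - (q ^ ((size p).-1 * npart L p 0))%N%:Z).
  move=> aL.
  have [sN sNW _ tN] := adp_gen sW eL aL; set N := gen L t.
  (* By [ordered], all exponents of [p] in the tail are at least [k], so the layers 0 and [k.-1] of
     [N] have the same size. *)
  have sub0 : psoc p 0 N \subset psoc p k.-1 W.
    apply: subset_trans (psocS _ _ sNW).
    have sub : psoc p k.-1 N \subset psoc p 0 N by apply: psoc_leq.
    suff -> : psoc p k.-1 N = psoc p 0 N by [].
    apply/eqP; rewrite eqEcard sub !tN // (_ : npart L p k.-1 = npart L p 0) ?leqnn //.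
    rewrite /npart; apply: eq_in_count => -[r j] Lrj /=; case: eqP => //= rp.
    have /allP/(_ _ Lrj)/implyP /= := ord1; rewrite rp eqxx => /(_ isT) kj.
    by rewrite prednK // kj (leq_trans k_gt0 kj).
  have cN : #|psoc p k.-1 W :&: N| = (q ^ ((size p).-1 * npart L p 0))%N.
    rewrite -tN //; apply: eq_card => y; rewrite inE; apply/andP/idP.
      by case=> /psocP[_ py _] Ny; apply/psocP; split=> //; exists y; rewrite ?scale1r.
    by move=> sy; split; [exact: (subsetP sub0) | exact: (subsetP (psoc_sub p 0 N))].
  have -> : (q ^ ((size p).-1 * \sum_(j < k.-1) npart L0 p j))%N = #|pker (p ^+ k.-1) W|.
    rewrite card_pker // big_distrr /= expn_sum; apply: eq_bigr => j _.
    by rewrite tW.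
  rewrite -tW // -cN subzn ?subset_leq_card ?subsetIl // -cardsD -PoszM.
  apply: (congr1 Posz); rewrite mulnC -card_preim_scale //.
    apply: eq_card => v; rewrite !inE /Q aL /= -/N; apply: andb_id2l => Wv.
    rewrite scalerA -exprS prednK // (submodZ _ sW Wv) /=.
    case pkv : (p ^+ k *: v == 0); rewrite /= ?andbF ?andbT //.
    by apply/esym/andb_idr=> _; apply/exists_inP; exists v.
  by move=> y /setDP[/psocP[]].
rewrite card_tupleS -IHL // (bigID (fun t : (size L).-tuple E => adp W L t)) /=.
rewrite [X in (_ + X)%N]big1 ?addn0; last first.
  by move=> t /negPf na; apply: eq_card0 => v; rewrite inE /Q na.
rewrite (big_morph Posz PoszD (erefl _)) (eq_bigr _ H) sumr_const -[LHS]mulr_natr natz.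
by congr (_ * Posz _); apply: eq_card => t; rewrite inE.
Qed.
End Adapted.

(** * Types of submodules *)

Lemma irreducible_factor (F : finFieldType) (f : {poly F}) : (1 < size f)%N ->
  exists p, [/\ irreducible_poly p, p \is monic & p %| f].
Proof.
have [m] := ubnP (size f); elim: m f => // m IHm f; rewrite ltnS => le_f f_gt1.
have f0 : f != 0 by rewrite -size_poly_gt0 ltnW.
have [irr_f|] := boolP (irreducibleb f).
  have lf : (lead_coef f)^-1 != 0 by rewrite invr_eq0 lead_coef_eq0.
  exists ((lead_coef f)^-1 *: f); split.
  - move/irreducibleP: irr_f => -[_ irr_f]; split; first by rewrite size_scale.
    by move=> g g1; rewrite dvdpZr // (eqp_rtrans (eqp_scale f lf)); apply: irr_f.
  - by rewrite monicE lead_coefZ mulVf // lead_coef_eq0.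
  - by rewrite dvdpZl.
rewrite /irreducibleb f_gt1 /= => /forallPn[g]; rewrite negb_imply -ltnNge -dvdpE.
case/andP=> gf g_gt1.
have ltgf : (size (polyn g) < size f)%N.
  by apply: leq_ltn_trans (size_npoly g) _; rewrite ltn_predL ltnW.
have [p [irr_p mon_p pg]] := IHm _ (leq_trans ltgf le_f) g_gt1.
by exists p; split=> //; apply: dvdp_trans pg gf.
Qed.

Lemma primary_factor (F : fieldType) (p f : {poly F}) : irreducible_poly p -> f != 0 ->
  exists k g, f = p ^+ k * g /\ ~~ (p %| g).
Proof.
move=> irr_p; have [m] := ubnP (size f); elim: m f => // m IHm f; rewrite ltnS => le_f f0.
have [/dvdpP[g fE]|npf] := boolP (p %| f); last by exists 0%N, f; rewrite expr0 mul1r.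
have g0 : g != 0 by apply: contra_neq f0 => g0; rewrite fE g0 mul0r.
have p0 := irredp_neq0 irr_p.
have ltgf : (size g < size f)%N.
  rewrite fE size_mul //; case: irr_p => p1 _.
  have lt_pred_add a b : (1 < b)%N -> (a < (a + b).-1)%N by lia.
  exact: lt_pred_add.
have [k [h [gE ph]]] := IHm _ (leq_trans ltgf le_f) g0.
by exists k.+1, h; split=> //; rewrite fE gE exprS mulrC mulrA.
Qed.

Section Types.
Variables (F : finFieldType) (E : finLmodType {poly F}).
Implicit Types (W N : {set E}) (p a b c : {poly F}) (v : E) (k : nat).
Implicit Types (L : seq ({poly F} * nat)) (vs : seq E).
Local Notation q := #|F|.

Let q_gt1 : (1 < q)%N := card_finNzRing_gt1 F.

(** [W] is a vector space over F[X]/(p). Its dimension is found by adjoining lines F[X] v, of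
    dimension deg p over F, until [W] is exhausted. *)
Lemma card_killed p W : irreducible_poly p -> submod W ->
  (forall x, x \in W -> p *: x = 0) -> exists r, #|W| = (q ^ ((size p).-1 * r))%N.
Proof.
move=> irr_p sW pW.
suff H m N r : submod N -> N \subset W -> #|N| = (q ^ ((size p).-1 * r))%N ->
    (#|W| - #|N| < m)%N -> exists r, #|W| = (q ^ ((size p).-1 * r))%N.
  apply: (H _ [set 0] 0%N _ _ _ (ltnSn _)); first exact: submod_set0.
    by rewrite sub1set submod0.
  by rewrite cards1 muln0.
elim: m N r => // m IHm N r sN sNW cN; rewrite ltnS => le_m.
have [sWN|/subsetPn[v Wv Nv]] := boolP (W \subset N).
  by exists r; rewrite -cN; apply: eq_card => x; apply/idP/idP; apply/subsetP.
have pv : p ^+ 1 *: v = 0 by rewrite expr1 pW.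
have p0v : p ^+ 1.-1 *: v \notin N by rewrite expr0 scale1r.
have cN' := card_addc sN irr_p pv p0v; rewrite cN muln1 -expnD addnC -mulnS in cN'.
have sN' := submod_addc sN irr_p pv; rewrite muln1 in sN'.
have sN'W : addc N v (size p).-1 \subset W.
  apply/subsetP=> x; rewrite -[(size p).-1]muln1 => /(addcP _ _ irr_p pv)[n Nn [a ->]].
  by rewrite submodD ?submodZ // (subsetP sNW).
apply: (IHm _ r.+1 sN' sN'W) => //; rewrite (leq_trans _ le_m) //.
have ltNN' : (#|N| < #|addc N v (size p).-1|)%N.
  rewrite cN' cN ltn_exp2l // ltn_mul2l ltnS leqnn andbT.
  by case: irr_p; case: (size p) => [|[]].
by rewrite ltn_sub2l // (leq_trans ltNN') // subset_leq_card.
Qed.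

(** Pigeonhole: there are [q ^ #|E|], hence more than [#|E|], polynomials of size at most [#|E|]. *)
Lemma torsion v : exists2 f : {poly F}, f != 0 & f *: v = 0.
Proof.
have [/injectiveP inj|/injectivePn[a [b ab abv]]] :=
  boolP (injectiveb (fun a : {poly_(#|E|) F} => polyn a *: v)).
  have := leq_card _ inj; rewrite card_npoly leqNgt ltn_expl //.
exists (polyn a - polyn b); last by rewrite scalerBl abv subrr.
by rewrite subr_eq0; apply: contra ab => /eqP ab; apply/eqP; apply: val_inj.
Qed.

(** By torsion and Bezout, every element is a sum of primary ones. If [p ^ k.+1] kills [x], then
    [p ^ k *: x] lies in the layer [k] and so equals [p ^ k *: n] with [n] in [N]; then [p ^ k]
    kills [x - n]. *)
Lemma submod_psoc_eq W N : submod W -> submod N -> N \subset W ->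
  (forall p j, irreducible_poly p -> p \is monic -> psoc p j W \subset psoc p j N) ->
  W = N.
Proof.
move=> sW sN /[dup] sNW /subsetP NW WN; apply/eqP; rewrite eqEsubset sNW andbT.
have kerN p k x : irreducible_poly p -> p \is monic -> x \in W -> p ^+ k *: x = 0 -> x \in N.
  move=> irr_p mon_p; elim: k x => [|k IHk] x Wx; first by rewrite scale1r => ->; rewrite submod0.
  move=> pkx; have /(subsetP (WN _ _ irr_p mon_p))/psocP[_ _ [n Nn kn]] : p ^+ k *: x \in psoc p k W.
    apply/psocP; split; rewrite ?submodZ //; first by rewrite scalerA -exprS.
    by exists x.
  rewrite -(subrK n x) submodD //; apply: IHk; first by rewrite submodB // NW.
  by rewrite scalerBr kn subrr.
apply/subsetP=> x Wx; have [f f0 fx] := torsion x.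
have [m] := ubnP (size f); elim: m f x Wx f0 fx => // m IHm f x Wx f0 fx; rewrite ltnS => le_f.
have [f_le1|f_gt1] := leqP (size f) 1.
  move: fx f0; rewrite (size1_polyC f_le1); set c := f`_0 => cx; rewrite polyC_eq0 => c0.
  have -> : x = c^-1%:P *: (c%:P *: x) by rewrite scalerA -polyCM mulVf // scale1r.
  by rewrite cx scaler0 submod0.
have [p [irr_p mon_p pf]] := irreducible_factor f_gt1.
have [k [g [fE pg]]] := primary_factor irr_p f0.
have k_gt0 : (0 < k)%N.
  by case: k fE => // fE; case/negP: pg; rewrite -[g]mul1r -(expr0 p) -fE.
have cop : coprimep (p ^+ k) g by rewrite coprimep_expl // irreducible_poly_coprime.
have /Bezout_eq1_coprimepP[[u w] /= uE] := cop.
rewrite -[x]scale1r -uE scalerDl -!scalerA submodD // submodZ //.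
  have g0 : g != 0 by apply: contra_neq f0 => g0; rewrite fE g0 mulr0.
  apply: (IHm g) => //; first by rewrite submodZ.
    by rewrite scalerA mulrC -fE.
  apply: leq_trans le_f.
  have pk0 : p ^+ k != 0 by rewrite expf_neq0 // irredp_neq0.
  rewrite fE size_mul // -ltnS prednK; last by rewrite addn_gt0 !size_poly_gt0 g0 pk0.
  rewrite -(prednK (_ : 0 < size (p ^+ k))%N) ?size_poly_gt0 // size_exp addSn ltnS.
  rewrite -[X in (X < _)%N]add0n ltn_add2r muln_gt0 k_gt0 andbT.
  by case: irr_p; case: (size p) => [|[]].
by apply: (kerN p k) => //; rewrite ?submodZ // scalerA -fE.
Qed.

Definition oftype L W := [exists t : (size L).-tuple E, adp setT L t && (gen L t == W)].

Lemma adp_sub W L vs : submod W -> eldiv L ->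
  adp W L vs = adp setT L vs && (gen L vs \subset W).
Proof.
move=> sW; elim: L vs => [|[p k] L IHL] [|v vs] //=.
  by rewrite sub1set submod0.
move=> /andP[/and3P[/irreducibleP irr_p mon_p k_gt0] eL]; rewrite IHL // in_setT /=.
have [aL|] /= := boolP (adp _ L vs); last by [].
have [sN _ _ _] := adp_gen (submod_setT _) eL aL.
have [/eqP pkv|] /= := boolP (_ == 0); last by rewrite !andbF.
case: (_ \notin _); rewrite ?andbF ?andbT //=; apply/andP/idP.
  case=> sub Wv; apply/subsetP=> x /(addcP _ _ irr_p pkv)[n Nn [a ->]].
  by rewrite submodD ?submodZ // (subsetP sub).
move=> sub; rewrite (subset_trans _ sub) ?sub_addc //; split=> //.
by rewrite (subsetP sub) // gen_addc.
Qed.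

Lemma oftypeP L W : eldiv L -> oftype L W ->
  [/\ submod W, #|W| = (q ^ weight L)%N & hastype W L].
Proof.
move=> eL /existsP[t /andP[aL /eqP<-]].
by have [] := adp_gen (submod_setT _) eL aL.
Qed.

(** The adapted tuples of [W] are grouped by the submodule that they generate. Any adapted tuple
    inside a submodule of type [L] generates it, by cardinality, so each group has [adpcount L L]
    members. *)
Lemma card_oftype W L L0 : submod W -> hastype W L0 -> eldiv L -> ordered L ->
  #|[set N : {set E} | (N \subset W) && oftype L N]|%:Z * adpcount L L = adpcount L L0.
Proof.
move=> sW tW eL oL; rewrite -(card_adp sW tW eL oL) -[in RHS]sum1_card.
rewrite (partition_big (fun t : (size L).-tuple E => gen L t)
   [in [set N : {set E} | (N \subset W) && oftype L N]]); last first.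
  move=> t; rewrite !inE adp_sub // => /andP[aT ->]; apply/existsP; exists t.
  by rewrite aT eqxx.
rewrite (big_morph Posz PoszD (erefl _)) mulrC -[_%:Z]natz mulr_natr -sumr_const.
apply: eq_bigr => N; rewrite inE => /andP[sNW oN].
have [sN cN tN] := oftypeP eL oN.
rewrite -(card_adp sN tN eL oL) -sum1_card; apply: (congr1 Posz).
apply: eq_bigl => t; rewrite !inE (adp_sub _ sN) // (adp_sub _ sW) // -andbA; apply: andb_id2l => aT.
have [_ _ ct _] := adp_gen (submod_setT _) eL aT.
apply/idP/andP => [sub|[_ /eqP->] //]; rewrite (subset_trans sub) //; split=> //.
by rewrite eqEcard sub ct cN /=.
Qed.

Lemma adpcount_gt0 L : eldiv L -> ordered L -> 0 < adpcount L L.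
Proof.
(* The recursion of [adpcount] shortens its first argument only; [L1] holds the pairs already
   removed. *)
suff H L1 L2 : eldiv L2 -> ordered L2 -> 0 < adpcount L2 (L1 ++ L2) by exact: (H [::]).
elim: L2 L1 => [|[p k] L2 IHL] L1 //= /andP[/and3P[/irreducibleP irr_p mon_p k_gt0] eL].
case/andP=> ord1 oL; rewrite -cat_rcons pmulr_lgt0 ?IHL // pmulr_rgt0; last by rewrite ltz_nat expn_gt0 ltnW.
rewrite subr_gt0 ltz_nat ltn_exp2l // ltn_pmul2l; last first.
  by case: irr_p; case: (size p) => [|[]].
rewrite cat_rcons /npart count_cat /= eqxx /= prednK // leqnn.
rewrite addnCA add1n ltnS (leq_trans _ (leq_addl _ _)) //.
rewrite (eq_in_count (a2 := fun x => (x.1 == p) && (k <= x.2)%N)) ?leqnn // => -[r j] Lrj /=.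
case: eqP => //= rp.
have /allP/(_ _ Lrj)/implyP /= := ord1; rewrite rp eqxx => /(_ isT) kj.
by rewrite kj (leq_trans k_gt0 kj).
Qed.

(** This stands in for the structure theorem: the positive count [adpcount L L] yields an adapted
    tuple in [W], and its span has the layers of [W], hence equals [W]. *)
Lemma hastype_oftype L W : submod W -> eldiv L -> ordered L -> hastype W L -> oftype L W.
Proof.
move=> sW eL oL tW; have := adpcount_gt0 eL oL.
rewrite -(card_adp sW tW eL oL) ltz_nat card_gt0 => /set0Pn[t]; rewrite inE => at_.
have [sN sNW _ tN] := adp_gen sW eL at_.
apply/existsP; exists t; move: at_; rewrite adp_sub // => /andP[-> _] /=.
rewrite eq_sym; apply/eqP; apply: submod_psoc_eq => // p j irr_p mon_p.
have := psocS p j sNW => sub; suff -> : psoc p j (gen L t) = psoc p j W by [].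
by apply/eqP; rewrite eqEcard sub (tN _ _ irr_p mon_p) (tW _ _ irr_p mon_p) leqnn.
Qed.

End Types.

(** * Matrices as modules and realization of types *)

Section MatrixModule.
Variables (F : finFieldType) (n : nat).

(* [g] acts on row vectors from the right. *)
Definition gmod (g : 'M[F]_n.+1) : Type := 'rV[F]_n.+1.

Variable g : 'M[F]_n.+1.

HB.instance Definition _ := FinRing.Zmodule.on (gmod g).

Definition gscale (a : {poly F}) (v : gmod g) : gmod g := v *m horner_mx g a.

Fact gscaleA a b v : gscale a (gscale b v) = gscale (a * b) v.
Proof. by rewrite /gscale -mulmxA -[_ *m horner_mx g a]rmorphM mulrC. Qed.
Fact gscale1 : left_id 1 gscale.
Proof. by move=> v; rewrite /gscale rmorph1 mulmx1. Qed.
Fact gscaleDr : right_distributive gscale +%R.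
Proof. by move=> a v w; rewrite /gscale mulmxDl. Qed.
Fact gscaleDl v : {morph gscale^~ v : a b / a + b}.
Proof. by move=> a b; rewrite /gscale rmorphD mulmxDr. Qed.

HB.instance Definition _ := GRing.Zmodule_isLmodule.Build {poly F} (gmod g)
  gscaleA gscale1 gscaleDr gscaleDl.

Lemma gscaleE a (v : gmod g) : a *: v = v *m horner_mx g a :> 'rV_n.+1.
Proof. by []. Qed.

End MatrixModule.


Section Transport.
Variables (F : finFieldType) (E1 E2 : finLmodType {poly F}) (f : E1 -> E2).
Hypotheses (f_inj : injective f) (fD : {morph f : x y / x + y}).
Hypothesis fZ : forall (a : {poly F}), {morph f : x / a *: x}.

Let f0 : f 0 = 0.
Proof. by rewrite -[X in f X](scale0r 0) fZ scale0r. Qed.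

Lemma gen_map L vs : gen L (map f vs) = f @: gen L vs.
Proof.
elim: L vs => [|[p k] L IHL] [|v vs] /=; rewrite ?imset_set1 ?f0 // IHL.
apply/setP=> x; apply/imsetP/imsetP.
  case=> -[y a] /setXP[/= /imsetP[z zg ->] _] ->.
  exists (z + polyn a *: v); last by rewrite fD fZ.
  by apply/imsetP; exists (z, a) => //; apply/setXP; rewrite inE.
case=> y /imsetP[[z a] /setXP[/= zg _] ->] ->.
exists (f z, a); last by rewrite /= fD fZ.
by apply/setXP; rewrite inE; split=> //; apply: imset_f.
Qed.

Lemma adp_map L vs : adp setT L vs -> adp setT L (map f vs).
Proof.
elim: L vs => [|[p k] L IHL] [|v vs] //= /and4P[/IHL-> _ /eqP pkv pk1v].
rewrite inE -fZ pkv f0 eqxx gen_map /= -fZ.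
by apply: contra pk1v => /imsetP[x xg /f_inj->].
Qed.
End Transport.

(** * Companion matrices and direct sums of cyclic modules *)

Section Companion.
Variables (F : finFieldType) (d : nat) (f : {poly F}).
Hypothesis sz_f : size f = d.+2.

Definition mulXmod (v : 'rV[F]_d.+1) : 'rV[F]_d.+1 := poly_rV ((rVpoly v * 'X) %% f).

Fact mulXmod_is_linear : linear mulXmod.
Proof.
move=> a v w; rewrite /mulXmod linearP /= mulrDl modpD -scalerAl modpZl.
exact: linearP.
Qed.
HB.instance Definition _ := GRing.isLinear.Build F _ _ _ mulXmod mulXmod_is_linear.

Definition companion := lin1_mx mulXmod.

Lemma horner_companion a (v : 'rV[F]_d.+1) :
  v *m horner_mx companion a = poly_rV ((rVpoly v * a) %% f).
Proof.
have sz b : (size (b %% f)%R <= d.+1)%N.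
  by rewrite -ltnS -sz_f ltn_modp -size_poly_eq0 sz_f.
elim/poly_ind: a v => [|a c IHa] v; first by rewrite rmorph0 mulmx0 mulr0 mod0p linear0.
rewrite rmorphD rmorphM /= horner_mx_X horner_mx_C mulmxDr mul_mx_scalar mulmxA IHa.
rewrite mul_rV_lin1 /= /mulXmod poly_rV_K // mulrDr modpD linearD /=; congr (_ + _).
  by congr poly_rV; rewrite mulrC modp_mul mulrC -mulrA.
rewrite mulrC mul_polyC modpZl linearZ /=; congr (_ *: _).
by rewrite modp_small ?rVpolyK // sz_f ltnS size_poly.
Qed.

End Companion.

Lemma horner_block (F : finFieldType) n m (g : 'M[F]_n.+1) (h : 'M[F]_m.+1) a :
  horner_mx (block_mx g 0 0 h : 'M[F]_((n + m.+1).+1)) a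
    = block_mx (horner_mx g a) 0 0 (horner_mx h a).
Proof.
elim/poly_ind: a => [|a c IHa].
  by rewrite !rmorph0; exact (esym (block_mx0 F n.+1 m.+1 n.+1 m.+1)).
rewrite !(rmorphD, rmorphM) /= !horner_mx_X !horner_mx_C IHa.
transitivity ((block_mx (horner_mx g a) 0 0 (horner_mx h a) *m block_mx g 0 0 h
  + c%:M) : 'M_(n.+1 + m.+1)) => //.
rewrite mulmx_block !(mulmx0, mul0mx, addr0, add0r).
by rewrite (@scalar_mx_block _ n.+1 m.+1) add_block_mx !addr0.
Qed.

Lemma row_horner_block (F : finFieldType) n m (g : 'M[F]_n.+1) (h : 'M[F]_m.+1) a
    (x : 'rV_n.+1) (y : 'rV_m.+1) :
  (row_mx x y : 'rV_((n + m.+1).+1))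
      *m horner_mx (block_mx g 0 0 h : 'M[F]_((n + m.+1).+1)) a
    = row_mx (x *m horner_mx g a) (y *m horner_mx h a).
Proof.
rewrite horner_block; have := mul_row_block x y (horner_mx g a) 0 0 (horner_mx h a).
by rewrite !(mulmx0, mul0mx, addr0, add0r).
Qed.

Lemma companion_adp (F : finFieldType) (p : {poly F}) k d :
    irreducible_poly p -> (0 < k)%N -> ((size p).-1 * k = d.+1)%N ->
  exists (g : 'M[F]_d.+1) (v : gmod g), p ^+ k *: v = 0 /\ p ^+ k.-1 *: v != 0.
Proof.
move=> irr_p k_gt0 dE.
have p0 := irredp_neq0 irr_p.
have sz_f : size (p ^+ k) = d.+2.
  rewrite -(prednK (_ : 0 < size (p ^+ k))%N) ?size_exp ?dE //.
  by rewrite size_poly_gt0 expf_neq0.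
exists (companion d (p ^+ k)), (poly_rV 1).
rewrite !gscaleE !horner_companion // poly_rV_K ?size_poly1 // !mul1r modpp linear0; split=> //.
have szk1 : (size (p ^+ k.-1) < size (p ^+ k))%N.
  rewrite -{2}(prednK k_gt0) exprS size_mul ?expf_neq0 //.
  have lt_pred_add a b : (1 < a)%N -> (b < (a + b).-1)%N by lia.
  by apply: lt_pred_add; case: irr_p.
rewrite modp_small //; apply: contraTneq (expf_neq0 k.-1 p0) => /(congr1 rVpoly).
by rewrite poly_rV_K ?linear0 => [->|]; rewrite ?eqxx // -ltnS -sz_f.
Qed.

(** Each pair (p, k) contributes the companion block of [p ^ k], with generator 1, on the diagonal.
    The empty list has weight 0 and would need a matrix of size 0. *)
Lemma exists_adp (F : finFieldType) (L : seq ({poly F} * nat)) : eldiv L -> L != [::] ->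
  exists n (g : 'M[F]_n.+1) (t : (size L).-tuple (gmod g)),
    n.+1 = weight L /\ adp setT L t.
Proof.
elim: L => // -[p k] L IHL /= /andP[/and3P[/irreducibleP irr_p mon_p k_gt0] eL] _.
have [d dE] : exists d, ((size p).-1 * k = d.+1)%N.
  exists ((size p).-1 * k).-1; rewrite prednK // muln_gt0 k_gt0 andbT.
  by case: irr_p; case: (size p) => [|[]].
have [g [v [pkv pk1v]]] := companion_adp irr_p k_gt0 dE.
have [L0|/(IHL eL)[n [h [t [nE ht]]]]] := eqVneq L [::].
  exists d, g; rewrite L0; exists [tuple v].
  by rewrite /weight big_seq1 -dE /= inE pkv eqxx inE pk1v.
pose G := block_mx h 0 0 g : 'M[F]_((n + d.+1).+1).
pose f (x : gmod h) : gmod G := row_mx x 0.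
pose w : gmod G := row_mx (0 : 'rV_n.+1) v.
have fZ a : {morph f : x / a *: x}.
  by move=> x; rewrite /f !gscaleE row_horner_block mul0mx.
have fD : {morph f : x y / x + y}.
  move=> x y; rewrite /f -[in LHS](addr0 (0 : 'rV[F]_d.+1)).
  exact: (esym (add_row_mx (x : 'rV_n.+1) 0 y 0)).
have f_inj : injective f by move=> x y /(@eq_row_mx F 1 n.+1 d.+1)[].
have wZ a : a *: w = row_mx (0 : 'rV_n.+1) (a *: v) :> gmod G.
  by rewrite !gscaleE row_horner_block mul0mx.
exists (n + d.+1)%N, G, [tuple of w :: map f t]; split.
  by rewrite /weight big_cons /= dE -/(weight L) -nE; lia.
rewrite /= adp_map // inE !wZ pkv row_mx0 eqxx /= gen_map //.
apply: contra pk1v => /imsetP[x _ /(@eq_row_mx F 1 n.+1 d.+1)[_ ->]].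
exact: eqxx.
Qed.

Lemma exists_oftype (F : finFieldType) (L : seq ({poly F} * nat)) : eldiv L ->
  exists (E : finLmodType {poly F}) (W : {set E}), oftype L W.
Proof.
move=> eL; have [->|L0] := eqVneq L [::].
  exists (gmod (0 : 'M[F]_1)), [set 0]; apply/existsP; exists [tuple] => /=.
  exact: eqxx.
have [n [g [t [_ ht]]]] := exists_adp eL L0.
by exists (gmod g), (gen L t); apply/existsP; exists t; rewrite ht eqxx.
Qed.

(** * Integrality of Hall polynomials *)

Lemma horner_lt_bound (p : {poly int}) d (x : nat) : (size p <= d.+1)%N -> (0 < x)%N ->
  `|p.[x%:Z]| <= (\sum_(i < d.+1) `|p`_i|) * x%:Z ^+ d.
Proof.
move=> le_p x0; rewrite (horner_coef_wide _ le_p) mulr_suml.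
apply: le_trans (ler_norm_sum _ _ _) _; apply: ler_sum => i _.
rewrite normrM ler_wpM2l // normrX ger0_norm //.
by apply: ler_weXn2l; rewrite ?lez_nat // -ltnS ltn_ord.
Qed.

(** With N = QD + R, the value of D divides that of R at infinitely many points. At large points it
    is also bigger in absolute value, so R has infinitely many roots. *)
Lemma monic_dvdp_of_values (N D : {poly int}) : D \is monic ->
  (forall m, exists2 x : nat, (m < x)%N & exists c : int, N.[x%:Z] = c * D.[x%:Z]) ->
  N = Pdiv.Ring.rdivp N D * D.
Proof.
move=> mD H; have NE := Pdiv.RingMonic.rdivp_eq mD N.
set Q := Pdiv.Ring.rdivp N D in NE *; set R := Pdiv.Ring.rmodp N D in NE.
have ltRD : (size R < size D)%N by rewrite Pdiv.Ring.ltn_rmodp monic_neq0.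
suff R0 : R = 0 by rewrite NE R0 addr0.
have D0 := monic_neq0 mD.
have [d dE] : exists d, size D = d.+1 by exists (size D).-1; rewrite prednK // size_poly_gt0.
case: d dE => [|d] dE; first by apply/eqP; rewrite -size_poly_leq0 -ltnS -dE.
rewrite dE ltnS in ltRD.
pose D' : {poly int} := D - 'X^(d.+1).
have szD' : (size D' <= d.+1)%N.
  apply/leq_sizeP => j; rewrite leq_eqVlt coefB coefXn => /predU1P[<-|ltj].
    by move/monicP: mD; rewrite /lead_coef dE /= eqxx => ->; rewrite subrr.
  by rewrite gtn_eqF // nth_default ?subrr // dE.
(* For x > S + T, the value of D is at least x^d (x - S) in absolute value, which exceeds x^d T, a
   bound for that of R. *)
pose S : int := \sum_(i < d.+1) `|D'`_i|; pose T : int := \sum_(i < d.+1) `|R`_i|.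
have S0 : 0 <= S by apply: sumr_ge0. have T0 : 0 <= T by apply: sumr_ge0.
have Rroot (x : nat) : (absz (S + T)%R < x)%N -> (exists c : int, N.[x%:Z] = c * D.[x%:Z]) ->
    R.[x%:Z] = 0.
  move=> ltx [c cE]; have x0 : (0 < x)%N by apply: leq_ltn_trans ltx.
  have ltxZ : S + T < x%:Z by rewrite -[S + T]gez0_abs ?addr_ge0.
  have bD := horner_lt_bound szD' x0; have bR := horner_lt_bound ltRD x0.
  rewrite -/S in bD; rewrite -/T in bR.
  have DE : D.[x%:Z] = x%:Z ^+ d * x%:Z + D'.[x%:Z].
    by rewrite /D' hornerD hornerN hornerXn exprSr; ring.
  have RE : R.[x%:Z] = (c - Q.[x%:Z]) * D.[x%:Z].
    by rewrite mulrBl -cE {1}NE hornerD hornerM; ring.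
  have xd0 : 0 < x%:Z ^+ d by rewrite exprn_gt0.
  have ltRDx : `|R.[x%:Z]| < `|D.[x%:Z]|.
    apply: le_lt_trans bR _; rewrite DE.
    have : x%:Z ^+ d * x%:Z - `|D'.[x%:Z]| <= `|x%:Z ^+ d * x%:Z + D'.[x%:Z]|.
      by apply: le_trans (ler_norm _); rewrite lerD2l lerNl -normrN ler_norm.
    apply: lt_le_trans; rewrite ltrBrDr (le_lt_trans (lerD (lexx _) bD)) //.
    by rewrite -mulrDl addrC mulrC ltr_pM2l.
  apply/eqP; apply: contraTT ltRDx => R0.
  rewrite -leNgt RE normrM ler_peMl //.
  have : c - Q.[x%:Z] != 0 by apply: contraNneq R0 => c0; rewrite RE c0 mul0r.
  lia.
have [xs [sxs srt rxs]] : exists xs : seq nat, [/\ size xs = size R,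
    sorted (fun x y => y < x)%N xs & all (fun x : nat => root R x%:Z) xs].
  elim: (size R) => [|s [xs [sxs srt rxs]]]; first by exists [::].
  have [x ltx cx] := H (maxn (absz (S + T)%R) (head 0%N xs)).
  rewrite gtn_max in ltx; case/andP: ltx => ltx ltxs.
  exists (x :: xs); split; rewrite /= ?sxs ?rxs /root ?Rroot // ?andbT ?eqxx //.
  by case: (xs) ltxs srt => //= y ys -> ->.
have uxs : uniq xs.
  by apply: sorted_uniq srt => [y x z /= xy yz|x]; [exact: ltn_trans yz xy | rewrite ltnn].
apply/eqP; apply: contraTT (leqnn (size R)) => R0.
rewrite -ltnNge -{1}sxs -(size_map (fun x : nat => x%:Z) xs) max_poly_roots //.
  by rewrite all_map.
by rewrite map_inj_uniq // => a b [].
Qed.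

Lemma PoszXn m n : (m ^ n)%N%:Z = m%:Z ^+ n.
Proof. by rewrite -!natz natrX. Qed.

Definition above (j : nat) (l : seq nat) := count (fun k => j < k)%N l.

(** The local factor of [adpcount] at one [p], with the indeterminate in place of q^(deg p); [l]
    lists the exponents of the submodule and [b] those of the ambient module. *)
Fixpoint Tpol (l b : seq nat) : {poly int} :=
  if l is k :: l' then
    'X^(\sum_(j < k.-1) above j b) * ('X^(above k.-1 b) - 'X^(size l')) * Tpol l' b
  else 1.

Definition lpart (F : finFieldType) (L : seq ({poly F} * nat)) p :=
  [seq x.2 | x <- L & x.1 == p].

Lemma npartE (F : finFieldType) (L : seq ({poly F} * nat)) p j :
  npart L p j = above j (lpart L p).
Proof. by rewrite /above /lpart count_map count_filter; apply: eq_count => x /=; rewrite andbC. Qed.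

Lemma above0 l : all (fun k => 0 < k)%N l -> above 0 l = size l.
Proof. by move=> l0; apply/eqP; rewrite -all_count. Qed.

Lemma adpcount_prod (F : finFieldType) (I : finType) (P : I -> {poly F}) L L0 :
    injective P -> eldiv L -> (forall x, x \in L -> exists i, x.1 = P i) ->
  adpcount L L0 = \prod_i (Tpol (lpart L (P i)) (lpart L0 (P i))).[(#|F| ^ (size (P i)).-1)%N%:Z].
Proof.
move=> Pinj; elim: L => [|[p k] L IHL] /=.
  by move=> _ _; rewrite big1 // => i _; rewrite hornerE.
move=> /andP[/and3P[_ _ k_gt0] eL] LP; have [i /= pE] := LP _ (mem_head _ _).
rewrite IHL //; last by move=> x Lx; apply: LP; rewrite inE Lx orbT.
rewrite (bigD1 i) //= [RHS](bigD1 i) //= mulrA; congr (_ * _); last first.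
  apply: eq_bigr => j ji; rewrite /lpart /= ifN // pE.
  by apply: contra ji => /eqP/Pinj->.
rewrite {3}/lpart /= pE eqxx /= -/(lpart L (P i)).
rewrite !hornerM hornerD hornerN !hornerXn !npartE.
rewrite (above0 (l := lpart L (P i))); last first.
  rewrite all_map all_filter; apply: sub_all eL => x /and3P[_ _ x0].
  by apply/implyP.
rewrite !expnM !PoszXn; under eq_bigr do rewrite npartE.
by [].
Qed.

(** In each difference the first exponent is larger: the head and, by sortedness, all of the tail
    exceed [k.-1]. The prefix [l1] holds the exponents already removed. *)
Lemma Tpol_monic l1 l2 : sorted leq l2 -> all (fun k => 0 < k)%N l2 ->
  Tpol l2 (l1 ++ l2) \is monic.
Proof.
elim: l2 l1 => [|k l2 IHl] l1 /= pl; first by rewrite monic1.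
move=> /andP[k_gt0 l2_gt0].
rewrite monicMr; last by rewrite -cat_rcons IHl // (path_sorted pl).
rewrite monicMl ?monicXn //.
have lt : (size l2 < above k.-1 (l1 ++ k :: l2))%N.
  rewrite /above count_cat /= prednK // leqnn addnCA add1n ltnS.
  rewrite (leq_trans _ (leq_addl _ _)) //.
  have /allP/(_ _ _) le_k := order_path_min leq_trans pl.
  by rewrite (eq_in_count (a2 := predT)) ?count_predT // => j /le_k.
by rewrite monicE lead_coefDl ?lead_coefXn // size_polyN !size_polyXn.
Qed.

(** The sum, over all cotypes, of the Hall polynomials for submodules of type [l] in a module of
    type [b]. *)
Definition hall (l b : seq nat) := Pdiv.Ring.rdivp (Tpol l b) (Tpol l l).

Lemma pairwise_ordered (F : finFieldType) (L : seq ({poly F} * nat)) :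
  (forall p, sorted leq (lpart L p)) -> ordered L.
Proof.
elim: L => [|[p k] L IHL] //= sL; apply/andP; split; last first.
  apply: IHL => r; have := sL r; rewrite /lpart /=.
  by case: ifP => // _ /path_sorted.
apply/allP => -[r j] Lrj /=; apply/implyP => /eqP pr.
have := sL p; rewrite /lpart /= eqxx /= => /(order_path_min leq_trans)/allP; apply.
by apply/mapP; exists (r, j) => //; rewrite mem_filter /= pr eqxx.
Qed.

(** At a prime ell, take a module of type [b] at the polynomial ['X] over the field with ell
    elements; as ['X] has degree 1, the counts are the values at ell. The quotient is then a number
    of submodules, hence an integer. *)
Lemma hallP l b : sorted leq l -> all (fun k => 0 < k)%N l ->
  sorted leq b -> all (fun k => 0 < k)%N b -> Tpol l b = hall l b * Tpol l l.
Proof.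
move=> sl l0 sb b0; apply: monic_dvdp_of_values; first exact: (@Tpol_monic [::]).
move=> m; have [ell lt_m pr_ell] := prime_above m; exists ell => //.
pose F : finFieldType := 'F_ell.
pose can (a : seq nat) : seq ({poly F} * nat) := [seq ('X, k) | k <- a].
have eldiv_can a : all (fun k => 0 < k)%N a -> eldiv (can a).
  move=> a0; rewrite /eldiv all_map; apply: sub_all a0 => k /= ->.
  rewrite monicX !andbT; apply/irreducibleP; rewrite -['X]subr0; exact: irredp_XsubC.
have lpart_can a : lpart (can a) 'X = a.
  rewrite /lpart filter_map -map_comp (eq_filter (a2 := predT)) ?filter_predT ?map_id // => k.
  exact: eqxx.
have ord_can a : sorted leq a -> ordered (can a).
  move=> sa; apply: pairwise_ordered => p.
  have [->|pX] := eqVneq p 'X; first by rewrite lpart_can.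
  rewrite /lpart filter_map (eq_filter (a2 := pred0)) ?filter_pred0 // => k /=.
  by rewrite eq_sym (negPf pX).
have cE a a' : all (fun k => 0 < k)%N a -> adpcount (can a) (can a') = (Tpol a a').[ell%:Z].
  move=> a0; rewrite (@adpcount_prod _ unit (fun=> 'X)) ?eldiv_can //.
  - rewrite (big_pred1 tt) => [|[]] //; rewrite !lpart_can size_polyX expn1.
    by rewrite card_Fp.
  - by move=> [] [].
  - by move=> x /mapP[k _ ->]; exists tt.
have [E [W oW]] := exists_oftype (eldiv_can _ b0).
have [sW _ tW] := oftypeP (eldiv_can _ b0) oW.
have := card_oftype sW tW (eldiv_can _ l0) (ord_can _ sl).
by rewrite !cE // => <-; eexists.
Qed.

(** * Families of local types and chains of submodules *)

(* [a k] is the multiplicity of the part [k.+1]. *)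
Definition ltype n := {ffun 'I_n -> 'I_n.+1}.

Definition parts n (a : ltype n) : seq nat := flatten [seq nseq (a j) j.+1 | j <- enum 'I_n].

Lemma aboveE n (a : ltype n) j : above j (parts a) = (\sum_(k < n | j <= k) a k)%N.
Proof.
rewrite /above /parts count_flatten -map_comp sumnE big_map big_enum [RHS]big_mkcond /=.
apply: eq_bigr => k _; rewrite count_nseq ltnS.
by case: leqP => _; rewrite ?mul1n ?mul0n.
Qed.

Lemma parts_gt0 n (a : ltype n) : all (fun k => 0 < k)%N (parts a).
Proof.
by apply/allP => k /flatten_mapP[j _]; rewrite mem_nseq => /andP[_ /eqP->].
Qed.

Lemma parts_sorted n (a : ltype n) : sorted leq (parts a).
Proof.
rewrite /parts; have : sorted ltn (map val (enum 'I_n)) by rewrite val_enum_ord iota_ltn_sorted.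
elim: (enum 'I_n) => //= j s IHs sj.
have {IHs} := IHs (path_sorted sj); set t := flatten _ => st.
have jt : all (leq j.+1) t.
  apply/allP => x /flatten_mapP[k ks]; rewrite mem_nseq => /andP[_ /eqP->].
  have := order_path_min ltn_trans sj => /allP/(_ (val k)); rewrite map_f // => /(_ isT).
  by rewrite !ltnS => /ltnW.
elim: (a j : nat) => //= c IHc; rewrite path_min_sorted // all_cat jt andbT.
by apply/allP => x; rewrite mem_nseq => /andP[_ /eqP->].
Qed.

Lemma parts_inj n (a a' : ltype n) :
  (forall j, above j (parts a) = above j (parts a')) -> a = a'.
Proof.
move=> eqa; apply/ffunP => k; apply: val_inj => /=.
have step (b : ltype n) : above k (parts b) = (b k + above k.+1 (parts b))%N.
  rewrite !aboveE (bigD1 k) //=; congr (_ + _)%N; apply: eq_bigl => j.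
  by rewrite ltn_neqAle eq_sym andbC.
by have := eqa k; rewrite !step eqa => /addIn.
Qed.

(** [r] is the conjugate partition: the part [k.+1] gets multiplicity [r k - r k.+1], and the sums
    telescope. *)
Lemma exists_parts n (r : nat -> nat) : (forall j, r j.+1 <= r j)%N -> (r 0 <= n)%N ->
  (forall j, n <= j -> r j = 0)%N -> exists a : ltype n, forall j, above j (parts a) = r j.
Proof.
move=> rS r0 rn.
have r_le j : (r j <= n)%N by elim: j => // j IHj; apply: leq_trans (rS j) IHj.
exists [ffun k : 'I_n => inord (r k - r k.+1)] => j; rewrite aboveE.
rewrite (eq_bigr (fun k : 'I_n => r k - r k.+1)%N) => [|k _]; last first.
  by rewrite ffunE inordK // ltnS (leq_trans (leq_subr _ _)).
have [m] := ubnP (n - j); elim: m j => // m IHm j le_m.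
have [le_nj|lt_jn] := leqP n j.
  by rewrite big_pred0 ?rn // => k; rewrite leqNgt (leq_trans (ltn_ord k)).
rewrite (bigD1 (Ordinal lt_jn)) //= (eq_bigl (fun k : 'I_n => j.+1 <= k)%N); last first.
  by move=> k; rewrite -val_eqE /= ltn_neqAle eq_sym andbC.
by rewrite IHm ?subnK // -ltnS (leq_trans _ le_m) // ltnS ltn_sub2l.
Qed.

Section Families.
Variables (F : finFieldType) (I : finType) (P : I -> {poly F}).
Hypotheses (Pinj : injective P) (Pirr : forall i, irreducible_poly (P i)).
Hypothesis Pmon : forall i, P i \is monic.
Local Notation q := #|F|.
Local Notation deg i := (size (P i)).-1.

Definition canon (l : I -> seq nat) : seq ({poly F} * nat) :=
  flatten [seq [seq (P i, k) | k <- l i] | i <- enum I].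

Lemma lpart_canon l i : lpart (canon l) (P i) = l i.
Proof.
rewrite /lpart /canon; have : uniq (enum I) by exact: enum_uniq.
have : i \in enum I by rewrite mem_enum.
have other s : i \notin s ->
    [seq x.2 | x <- flatten [seq [seq (P i, k) | k <- l i] | i <- s] & x.1 == P i] = [::].
  elim: s => //= j s IHs; rewrite inE negb_or => /andP[ij si].
  rewrite filter_cat map_cat IHs // cats0 filter_map (eq_filter (a2 := pred0)) ?filter_pred0 // => k /=.
  by rewrite (inj_eq Pinj) eq_sym (negPf ij).
elim: (enum I) => //= j s IHs; rewrite inE filter_cat map_cat => js /andP[sj us].
have [ij|ij] := eqVneq i j.
  rewrite -ij other ?ij // cats0 filter_map (eq_filter (a2 := predT)) ?filter_predT => [|k /=].
    by rewrite -map_comp map_id.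
  exact: eqxx.
rewrite IHs //; last by move: js; rewrite (negPf ij).
rewrite filter_map (eq_filter (a2 := pred0)) ?filter_pred0 // => k /=.
by rewrite (inj_eq Pinj) eq_sym (negPf ij).
Qed.

Lemma canon_mem l x : x \in canon l -> exists i, x.1 = P i.
Proof. by case/flatten_mapP => i _ /mapP[k _ ->]; exists i. Qed.

Lemma lpart_canon_out l p : (forall i, p != P i) -> lpart (canon l) p = [::].
Proof.
move=> pP; apply/eqP; rewrite -size_eq0 size_map size_filter -leqn0 leqNgt -has_count.
by apply/hasPn => x /canon_mem[i ->]; rewrite eq_sym pP.
Qed.

Lemma eldiv_canon l : (forall i, all (fun k => 0 < k)%N (l i)) -> eldiv (canon l).
Proof.
move=> l0; apply/allP => _ /flatten_mapP[i _ /mapP[k lk ->]] /=.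
by rewrite Pmon (allP (l0 i)) // !andbT; apply/irreducibleP.
Qed.

Lemma ordered_canon l : (forall i, sorted leq (l i)) -> ordered (canon l).
Proof.
move=> sl; apply: pairwise_ordered => p.
have [/existsP[i /eqP->]|/existsPn pP] := boolP [exists i, p == P i].
  by rewrite lpart_canon.
by rewrite lpart_canon_out.
Qed.

Lemma weight_canon l : weight (canon l) = (\sum_i deg i * sumn (l i))%N.
Proof.
rewrite /weight /canon big_flatten big_map big_enum /=; apply: eq_bigr => i _.
by rewrite big_map /= -big_distrr /= sumnE.
Qed.


Variable n : nat.
Implicit Types m : {ffun I -> ltype n}.
Definition fcanon m := canon (fun i => parts (m i)).

Lemma eldiv_fcanon m : eldiv (fcanon m).
Proof. by apply: eldiv_canon => i; apply: parts_gt0. Qed.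
Lemma ordered_fcanon m : ordered (fcanon m).
Proof. by apply: ordered_canon => i; apply: parts_sorted. Qed.

Variable E : finLmodType {poly F}.
Implicit Types (W N : {set E}).

Definition supported W := forall p x, irreducible_poly p -> p \is monic ->
  (forall i, p != P i) -> x \in W -> p *: x = 0 -> x = 0.

Let q_gt1 : (1 < q)%N := card_finNzRing_gt1 F.
Let deg_gt0 i : (0 < deg i)%N.
Proof. by case: (Pirr i); case: (size (P i)) => [|[]]. Qed.

(** A nonzero element of the layer [j] yields a copy of F[X]/(p^(j+1)) in [W], which has more than
    q^n elements. *)
Lemma psoc_big W p j : irreducible_poly p -> submod W -> (#|W| <= q ^ n)%N -> (n <= j)%N ->
  psoc p j W = [set 0].
Proof.
move=> irr_p sW le_W le_j; apply/eqP; rewrite eqEsubset sub1set submod0 ?submod_psoc // andbT.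
apply/subsetP => x /psocP[_ px [w Ww xE]]; rewrite inE; apply: contraTT le_W => x0.
have pjw : p ^+ j.+1 *: w = 0 by rewrite exprS -scalerA -xE.
have pjw0 : p ^+ j.+1.-1 *: w \notin [set 0] by rewrite inE -xE.
rewrite -ltnNge.
have := card_addc (submod_set0 E) irr_p pjw pjw0; rewrite cards1 mul1n => cN.
have : (q ^ ((size p).-1 * j.+1) <= #|W|)%N.
  rewrite -cN subset_leq_card //; apply/subsetP => y /(addcP _ _ irr_p pjw)[z].
  by rewrite inE => /eqP-> [a ->]; rewrite add0r submodZ.
apply: leq_trans; rewrite ltn_exp2l // (leq_ltn_trans le_j) //.
by rewrite leq_pmull //; case: irr_p; case: (size p) => [|[]].
Qed.

(** At each [P i], the layer dimensions decrease, start at most at n and vanish from n on, so they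
    form the conjugate of a partition. *)
Lemma type_exists W : submod W -> supported W -> (#|W| <= q ^ n)%N -> exists m, oftype (fcanon m) W.
Proof.
move=> sW suppW le_W.
have /fin_all_exists[a aE] i : exists a : ltype n,
    forall j, #|psoc (P i) j W| = (q ^ (deg i * above j (parts a)))%N.
  have ex_r j : exists r, #|psoc (P i) j W| == (q ^ (deg i * r))%N.
    have [|r rE] := card_killed (Pirr i) (submod_psoc (P i) j sW); first by move=> x /psocP[].
    by exists r; apply/eqP.
  pose r j := xchoose (ex_r j).
  have rE j : #|psoc (P i) j W| = (q ^ (deg i * r j))%N by apply/eqP/(xchooseP (ex_r j)).
  have [| | |a aE] := @exists_parts n r; last by exists a => j; rewrite aE rE.
  - move=> j; have := subset_leq_card (psoc_leq (P i) sW (leqnSn j)).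
    by rewrite !rE leq_exp2l // leq_pmul2l.
  - have := subset_leq_card (psoc_sub (P i) 0 W); rewrite rE => /leq_trans/(_ le_W).
    by rewrite leq_exp2l //; apply: leq_trans; rewrite leq_pmull.
  - move=> j le_j; have := rE j; rewrite psoc_big // cards1 => /esym/eqP.
    by rewrite -(expn0 q) eqn_exp2l // muln_eq0 gtn_eqF //= => /eqP.
exists [ffun i => a i]; apply: hastype_oftype; rewrite ?eldiv_fcanon ?ordered_fcanon //.
move=> p j irr_p mon_p; rewrite npartE.
have [/existsP[i /eqP->]|/existsPn pP] := boolP [exists i, p == P i].
  by rewrite lpart_canon ffunE aE.
rewrite lpart_canon_out // muln0 expn0 -(cards1 (0 : E)); apply: eq_card => x.
apply/idP/idP => [/psocP[Wx px _]|]; first by rewrite inE (suppW p x irr_p).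
by rewrite inE => /eqP->; rewrite submod0 ?submod_psoc.
Qed.

Lemma hastype_supported W m : submod W -> hastype W (fcanon m) -> supported W.
Proof.
move=> sW tW p x irr_p mon_p pP Wx px; apply/eqP; rewrite -in_set1.
suff <- : psoc p 0 W = [set 0] by apply/psocP; split=> //; exists x; rewrite ?scale1r.
apply/eqP; rewrite eq_sym eqEcard sub1set submod0 ?submod_psoc //.
by rewrite tW // npartE lpart_canon_out // muln0 cards1.
Qed.

Lemma type_uniq W m m' : hastype W (fcanon m) -> hastype W (fcanon m') -> m = m'.
Proof.
move=> tm tm'; apply/ffunP => i; apply: parts_inj => j.
have := tm _ j (Pirr i) (Pmon i); rewrite (tm' _ _ (Pirr i) (Pmon i)) !npartE !lpart_canon.
by move/eqP; rewrite eqn_exp2l // eqn_pmul2l // => /eqP.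
Qed.

(** Both sides of [card_oftype] factor over [i]; by [hallP] the nonzero factor [adpcount L L]
    cancels. *)
Lemma card_submod_type W m m' : submod W -> hastype W (fcanon m) ->
  #|[set N : {set E} | (N \subset W) && oftype (fcanon m') N]|%:Z
    = \prod_i (hall (parts (m' i)) (parts (m i))).[(q ^ deg i)%N%:Z].
Proof.
move=> sW tW; have := adpcount_gt0 (eldiv_fcanon m') (ordered_fcanon m').
have := card_oftype sW tW (eldiv_fcanon m') (ordered_fcanon m').
have memP x : x \in fcanon m' -> exists i, x.1 = P i by apply: canon_mem.
rewrite !(adpcount_prod _ Pinj) ?eldiv_fcanon // => + D0.
under [in RHS]eq_bigr => i _ do rewrite !lpart_canon.
under eq_bigr => i _ do rewrite !lpart_canon.
under [in RHS]eq_bigr => i _ do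
  rewrite hallP ?parts_sorted ?parts_gt0 // hornerM.
rewrite big_split /= => /mulIf; apply.
by move: D0; under eq_bigr => i _ do rewrite !lpart_canon; move/lt0r_neq0.
Qed.

End Families.

(** Generating polynomial of the descending chains of submodules of [W]: a member of dimension e in
    position i contributes e times the i-th entry of [bs] to the exponent. The logarithm recovers
    the dimension over [F]. *)
Fixpoint chainpoly (F : finFieldType) (E : finLmodType {poly F}) (bs : seq nat) (W : {set E}) :
    {poly int} :=
  if bs is b :: bs' then
    \sum_(N : {set E} | (N \subset W) && submod N)
      'X^(b * trunc_log #|F| #|N|) * chainpoly bs' N
  else 1.

(** The analogue of [chainpoly] at a single [p]: the inner variable z stands for q^(deg p), and
    lengths replace dimensions; [adams] restores the factor deg p between them. *)
Fixpoint locpoly n (bs : seq nat) (a : ltype n) : {poly {poly int}} :=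
  if bs is b :: bs' then
    \sum_(a' : ltype n) (hall (parts a') (parts a))%:P * 'X^(b * sumn (parts a')) * locpoly bs' a'
  else 1.

(* The substitution [z -> z^D, y -> y^D] followed by the evaluation [z = q]. *)
Definition adams (q D : nat) (C : {poly {poly int}}) : {poly int} :=
  map_poly (horner_eval (q ^ D)%N%:Z) C \Po 'X^D.

Section Adams.
Variables q D : nat.

Fact adams_is_zmod_morphism : zmod_morphism (adams q D).
Proof. by move=> C C'; rewrite /adams rmorphB /= rmorphB. Qed.
Fact adams_is_monoid_morphism : monoid_morphism (adams q D).
Proof. by split=> [|C C']; rewrite /adams ?rmorph1 // rmorphM /= rmorphM. Qed.

HB.instance Definition _ := GRing.isZmodMorphism.Build _ _ (adams q D) adams_is_zmod_morphism.
HB.instance Definition _ := GRing.isMonoidMorphism.Build _ _ (adams q D) adams_is_monoid_morphism.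

Lemma adamsC c : adams q D c%:P = (c.[(q ^ D)%N%:Z])%:P.
Proof. by rewrite /adams map_polyC comp_polyC. Qed.
Lemma adamsXn k : adams q D 'X^k = 'X^(D * k).
Proof. by rewrite /adams map_polyXn comp_Xn_poly exprM. Qed.

End Adams.

Section ChainProduct.
Variables (F : finFieldType) (I : finType) (P : I -> {poly F}).
Hypotheses (Pinj : injective P) (Pirr : forall i, irreducible_poly (P i)).
Hypothesis Pmon : forall i, P i \is monic.
Variables (n : nat) (E : finLmodType {poly F}).

Local Notation q := #|F|.
Local Notation deg i := (size (P i)).-1.
Implicit Types m : {ffun I -> ltype n}.

Lemma dim_type m (N : {set E}) : oftype (fcanon P m) N ->
  trunc_log q #|N| = (\sum_i deg i * sumn (parts (m i)))%N.
Proof.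
case/(oftypeP (eldiv_fcanon Pirr Pmon m)) => _ -> _.
by rewrite trunc_expnK ?card_finNzRing_gt1 // weight_canon.
Qed.

(** Expanding the product of local sums gives a sum over families [m']. It matches the sum over the
    first member [N] of the chain, grouped by its type, because the rest of the chain depends on
    that type only. *)
Lemma chainpoly_prod bs m (W : {set E}) : submod W -> (#|W| <= q ^ n)%N ->
    hastype W (fcanon P m) ->
  chainpoly bs W = \prod_i adams q (deg i) (locpoly bs (m i)).
Proof.
elim: bs m W => [|b bs IHb] m W sW le_W tW /=.
  by rewrite big1 // => i _; rewrite rmorph1.
under [RHS]eq_bigr => i _ do rewrite rmorph_sum.
rewrite bigA_distr_bigA /=.
transitivity (\sum_(m' : {ffun I -> ltype n})
    \sum_(N in [set N : {set E} | (N \subset W) && oftype (fcanon P m') N])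
      'X^(b * trunc_log q #|N|) * chainpoly bs N).
  rewrite (exchange_big_dep (fun N : {set E} => (N \subset W) && submod N)) /=; last first.
    by move=> m' N _; rewrite inE => /andP[-> /(oftypeP (eldiv_fcanon Pirr Pmon m'))[]].
  apply: eq_bigr => N /andP[sNW sN].
  have [||m' om'] := type_exists Pinj Pirr Pmon sN (n := n).
  - by move=> p x ip mp pP Nx; apply: (hastype_supported sW tW ip mp pP) (subsetP sNW _ Nx).
  - exact: leq_trans (subset_leq_card sNW) le_W.
  rewrite (big_pred1 m') // => m'' /=; rewrite inE sNW /=; apply/idP/eqP => [om''|-> //].
  have [_ _ t'] := oftypeP (eldiv_fcanon Pirr Pmon m') om'.
  have [_ _ t''] := oftypeP (eldiv_fcanon Pirr Pmon m'') om''.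
  exact: (type_uniq Pinj Pirr Pmon t'' t').
apply: eq_bigr => m' _.
rewrite (eq_bigr (fun=> 'X^(b * \sum_i deg i * sumn (parts (m' i)))
    * \prod_i adams q (deg i) (locpoly bs (m' i)))) => [|N]; last first.
  rewrite inE => /andP[sNW oN]; rewrite (dim_type oN).
  have [sN _ tN] := oftypeP (eldiv_fcanon Pirr Pmon m') oN.
  by rewrite (IHb m') //; exact: leq_trans (subset_leq_card sNW) le_W.
rewrite sumr_const -mulr_natl.
under [RHS]eq_bigr => i _ do rewrite !rmorphM /= adamsC adamsXn.
rewrite !big_split /= -(rmorph_prod polyC) -(card_submod_type Pinj Pirr Pmon m' sW tW).
rewrite mulrA; congr (_ * _ * _); first by rewrite -natz rmorph_nat.
by rewrite big_distrr /= expr_sum; apply: eq_bigr => i _; rewrite mulnCA.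
Qed.

End ChainProduct.

(** * Euler products over monic irreducible polynomials *)

Definition eqmodX N (a b : {poly int}) := exists c, a = b + c * 'X^N.

Section EqmodX.
Variable N : nat.
Implicit Types a b c d : {poly int}.

Lemma eqmodX_refl a : eqmodX N a a. Proof. by exists 0; rewrite mul0r addr0. Qed.
Lemma eqmodX_sym a b : eqmodX N a b -> eqmodX N b a.
Proof. by case=> c ->; exists (- c); rewrite mulNr addrK. Qed.
Lemma eqmodX_trans a b c : eqmodX N a b -> eqmodX N b c -> eqmodX N a c.
Proof. by case=> d -> [e ->]; exists (e + d); rewrite mulrDl addrA. Qed.
Lemma eqmodXD a b c d : eqmodX N a b -> eqmodX N c d -> eqmodX N (a + c) (b + d).
Proof. by case=> e -> [f ->]; exists (e + f); ring. Qed.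
Lemma eqmodXN a b : eqmodX N a b -> eqmodX N (- a) (- b).
Proof. by case=> c ->; exists (- c); rewrite opprD mulNr. Qed.
Lemma eqmodXM a b c d : eqmodX N a b -> eqmodX N c d -> eqmodX N (a * c) (b * d).
Proof. by case=> e -> [f ->]; exists (b * f + e * d + e * f * 'X^N); ring. Qed.
Lemma eqmodXMl a b c : eqmodX N b c -> eqmodX N (a * b) (a * c).
Proof. exact/eqmodXM/eqmodX_refl. Qed.
Lemma eqmodX_prod (I : Type) (r : seq I) (f g : I -> {poly int}) :
  (forall i, eqmodX N (f i) (g i)) -> eqmodX N (\prod_(i <- r) f i) (\prod_(i <- r) g i).
Proof.
move=> fg; elim: r => [|i r IHr]; rewrite ?big_nil ?big_cons; first exact: eqmodX_refl.
exact: eqmodXM.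
Qed.
Lemma eqmodX_sum0 (I : Type) (r : seq I) (A : pred I) (f : I -> {poly int}) :
  (forall i, A i -> eqmodX N (f i) 0) -> eqmodX N (\sum_(i <- r | A i) f i) 0.
Proof.
move=> f0; elim/big_ind: _ => [|a b a0 b0|i /f0//]; first exact: eqmodX_refl.
by rewrite -[0]addr0; apply: eqmodXD.
Qed.
Lemma eqmodXn k : (N <= k)%N -> eqmodX N 'X^k 0.
Proof. by move=> le; exists 'X^(k - N); rewrite add0r -exprD subnK. Qed.
Lemma eqmodX_comp k c a b : (0 < k)%N -> eqmodX N a b ->
  eqmodX N (a \Po (c * 'X^k)) (b \Po (c * 'X^k)).
Proof.
move=> k0 [d ->]; exists ((d \Po (c * 'X^k)) * c ^+ N * 'X^(k * N - N)).
rewrite rmorphD rmorphM /= comp_Xn_poly exprMn -exprM -[in 'X^(k * N)](@subnK N (k * N)) ?leq_pmull // exprD.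
by rewrite !mulrA.
Qed.
Lemma eqmodX_coef a b e : eqmodX N a b -> (e < N)%N -> a`_e = b`_e.
Proof. by case=> c -> ltN; rewrite coefD coefMXn ltN addr0. Qed.

Lemma geom_mod c k : (0 < k)%N -> eqmodX N ((1 - c * 'X^k) * \sum_(i < N) (c * 'X^k) ^+ i) 1.
Proof.
move=> k_gt0; rewrite -opprB mulNr -subrX1 opprB exprMn -exprM.
exists (- c ^+ N * 'X^(k * N - N)).
by rewrite -mulrA -exprD subnK ?leq_pmull // mulNr.
Qed.

Lemma eqmodX_inv a b c d : eqmodX N (a * b) c -> eqmodX N (b * d) 1 -> eqmodX N a (c * d).
Proof.
move=> ab bd; apply: (@eqmodX_trans _ (a * b * d)).
  by rewrite -mulrA -{1}[a]mulr1; apply/eqmodXMl/eqmodX_sym.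
exact: eqmodXM ab (eqmodX_refl d).
Qed.
End EqmodX.

(** * Unique factorization in F[X] as a sieve *)

Section Sieve.
Variables (F : finFieldType) (N : nat).
Local Notation q := #|F|.
Implicit Types (s : seq {poly F}) (p : {poly F}).

Definition sifted s : pred {poly_N F} :=
  fun f => (polyn f \is monic) && all (fun p => ~~ (p %| polyn f)) s.
Definition siftsum s : {poly int} := \sum_(f | sifted s f) 'X^((size (polyn f)).-1).

(** The monic polynomials of degree i are ['X^i + g] with [g] of size at most i, so there are q^i of
    them. *)
Lemma siftsum_nil : siftsum [::] = \sum_(i < N) (q%:Z%:P * 'X) ^+ i.
Proof.
rewrite /siftsum; have [n0|N0] := posnP N.
  rewrite [in RHS]n0 big_ord0 big_pred0 // => f; rewrite /sifted.
  have := size_npoly f; rewrite {2}n0 size_poly_leq0 => /eqP ->.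
  by rewrite monicE lead_coef0 eq_sym oner_eq0.
have szP (f : {poly_N F}) : ((size (polyn f)).-1 < N)%N.
  by rewrite -ltnS; case: (size _) (size_npoly f) => //= k; rewrite ltnS.
rewrite (partition_big (fun f : {poly_N F} => Ordinal (szP f)) predT) //=.
apply: eq_bigr => i _; rewrite exprMn -polyC_exp.
have szX : size ('X^i : {poly F}) = i.+1 by rewrite size_polyXn.
have szD (g : {poly_i F}) : (size (polyn g) < size ('X^i : {poly F})%R)%N.
  by rewrite szX ltnS size_npoly.
pose h (g : {poly_i F}) := npolyp N ('X^i + polyn g).
have hE g : polyn (h g) = 'X^i + polyn g.
  by rewrite /h npolypK // size_polyDl // szX.
rewrite (eq_bigr (fun=> 'X^i)) => [|f /andP[_ /eqP<-]] //.
rewrite sumr_const -mulr_natl -PoszXn -[X in X%:P]natz polyC_natr; congr (_%:R * _).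
rewrite -(card_npoly F i) -(card_imset predT (_ : injective h)); last first.
  move=> g g' /(congr1 (@polyn F N)); rewrite !hE => /addrI gg; exact: val_inj.
apply: eq_card => f; rewrite unfold_in /sifted /= andbT -val_eqE /=.
apply/andP/imsetP => [[mf /eqP fi]|[g _ ->]]; last first.
  by rewrite hE size_polyDl // szX eqxx monicE lead_coefDl // lead_coefXn.
have szf : size (polyn f) = i.+1.
  by rewrite -fi prednK // size_poly_gt0 monic_neq0.
have le : (size (polyn f - 'X^i)%R <= i)%N.
  apply/leq_sizeP => j; rewrite leq_eqVlt coefB coefXn => /predU1P[<-|ltj].
    by move/monicP: mf; rewrite /lead_coef szf /= eqxx => ->; rewrite subrr.
  by rewrite gtn_eqF // nth_default ?subrr // szf.
exists (NPoly le) => //; apply: val_inj; rewrite /= hE /=.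
by rewrite addrC subrK.
Qed.

(** Multiplication by [p] maps the sifted polynomials onto the sifted multiples of [p], since the
    members of [s] are coprime to [p]. Products too large for the degree bound have degree at least
    [N], so they vanish in the congruence. *)
Lemma siftsum_cons p s : irreducible_poly p -> p \is monic ->
    (forall r, r \in s -> [/\ irreducible_poly r, r \is monic & r != p]) ->
  eqmodX N (siftsum (p :: s)) ((1 - 'X^((size p).-1)) * siftsum s).
Proof.
move=> irr_p mon_p sP; have p0 := irredp_neq0 irr_p.
have split_s : siftsum s = siftsum (p :: s)
    + \sum_(f | sifted s f && (p %| polyn f)) 'X^((size (polyn f)).-1).
  rewrite /siftsum (bigID (fun f : {poly_N F} => p %| polyn f)) /= addrC.
  by congr (_ + _); apply: eq_bigl => f; rewrite /sifted /= -andbA; congr (_ && _); rewrite andbC.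
have dvd_sum : eqmodX N ('X^((size p).-1) * siftsum s)
    (\sum_(f | sifted s f && (p %| polyn f)) 'X^((size (polyn f)).-1)).
  rewrite /siftsum mulr_sumr (bigID (fun f : {poly_N F} => (size (p * polyn f)%R <= N)%N)) /=.
  rewrite -[X in eqmodX _ _ X]addr0; apply: eqmodXD; last first.
    apply: eqmodX_sum0 => f /andP[/andP[mf _]]; rewrite -ltnNge -exprD => lt.
    apply: eqmodXn; move: lt; rewrite size_mul ?monic_neq0 //.
    have := size_poly_gt0 p; have := size_poly_gt0 (polyn f).
    rewrite p0 monic_neq0 //; case: (size p) => // u; case: (size (polyn f)) => // v _ _.
    by rewrite addnS /= addSn ltnS.
  pose h (f : {poly_N F}) := npolyp N (p * polyn f).
  pose h' (f : {poly_N F}) := npolyp N (polyn f %/ p).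
  have h'E f : polyn (h' f) = polyn f %/ p.
    by rewrite /h' npolypK // (leq_trans (leq_divp _ _)) // size_npoly.
  rewrite [in X in eqmodX _ _ X](reindex_onto h h') => [|f /andP[_ pf]]; last first.
    apply: val_inj; rewrite /= /h npolypK h'E; last by rewrite mulrC divpK // size_npoly.
    by rewrite mulrC divpK.
  rewrite (_ : \sum_(f | _) _ = \sum_(f | sifted s (h f) && (p %| polyn (h f)) && (h' (h f) == f))
    'X^((size (polyn (h f))).-1)); first exact: eqmodX_refl.
  apply: eq_big => [f|f /andP[/andP[mf _] le]]; last first.
    rewrite /h npolypK // size_mul ?monic_neq0 // -exprD; congr 'X^_.
    have := size_poly_gt0 p; have := size_poly_gt0 (polyn f).
    rewrite p0 monic_neq0 //; case: (size p) => // u; case: (size (polyn f)) => // v _ _.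
    by rewrite /= addnS.
  rewrite /= -[h' _ == f]val_eqE /= h'E.
  have [le|gt] /= := leqP (size (p * polyn f)%R) N.
    rewrite /sifted /h npolypK // monicMl // dvdp_mulIl mulKp // eqxx !andbT.
    congr (_ && _); apply: eq_in_all => r rs; have [irr_r mon_r rp] := sP r rs.
    rewrite Gauss_dvdpr // irreducible_poly_coprime //; apply: contra rp => dv.
    have r1 : size r != 1%N by case: irr_r => + _; case: (size r) => [|[]].
    by rewrite -eqp_monic // irr_p.
  rewrite andbF; apply/esym; apply: contraTF gt => /andP[/andP[_ /dvdpP[g gE]] /eqP fE].
  by rewrite -leqNgt mulrC -fE gE mulpK // -gE size_npoly.
rewrite mulrBl mul1r {1}split_s.
apply: (@eqmodX_trans _ _ (siftsum (p :: s) +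
  \sum_(f | sifted s f && (p %| polyn f)) 'X^((size (polyn f)).-1) -
  \sum_(f | sifted s f && (p %| polyn f)) 'X^((size (polyn f)).-1))).
  by rewrite addrK; apply: eqmodX_refl.
apply: eqmodXD; first exact: eqmodX_refl.
by apply/eqmodXN/eqmodX_sym.
Qed.

End Sieve.

(** The size bound keeps degrees below [N], which makes the type finite. ['X] is left out because it
    acts bijectively on the module of an invertible matrix. *)
Notation primeX F N := {p : {poly_N F} |
  [&& irreducibleb (polyn p), polyn p \is monic & polyn p != 'X]}.
Definition primeX_poly (F : finFieldType) N (i : primeX F N) : {poly F} := polyn (val i).

Section PrimeX.
Variables (F : finFieldType) (N : nat).
Local Notation P := (@primeX_poly F N).

Lemma primeX_inj : injective P.
Proof. by move=> i j /val_inj/val_inj. Qed.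
Lemma primeX_irr i : irreducible_poly (P i).
Proof. by apply/irreducibleP; case/and3P: (valP i). Qed.
Lemma primeX_monic i : P i \is monic.
Proof. by case/and3P: (valP i). Qed.
Lemma primeX_neqX i : P i != 'X.
Proof. by case/and3P: (valP i). Qed.
Lemma primeX_mem p : irreducible_poly p -> p \is monic -> p != 'X -> (size p <= N)%N ->
  exists i, p = P i.
Proof.
move=> /irreducibleP irr_p mon_p pX le_p.
have pP : [&& irreducibleb (polyn (NPoly le_p)), polyn (NPoly le_p) \is monic
              & polyn (NPoly le_p) != 'X] by rewrite /= irr_p mon_p pX.
by exists (Sub (NPoly le_p) pP); rewrite /primeX_poly SubK.
Qed.

(** Sifting by ['X] and all other monic irreducible polynomials of degree below [N] leaves the
    polynomial 1 alone, while the unsifted sum is the inverse of 1 - qy modulo ['X^N]. The factor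
    [1 - 'X] restores the polynomial missing from [primeX]. *)
Lemma euler_base : (1 < N)%N ->
  eqmodX N ((1 - 'X) * \prod_i (1 - 'X^((size (P i)).-1))) (1 - #|F|%:Z%:P * 'X).
Proof.
move=> N1; pose s := 'X :: map P (enum {: primeX F N}).
have irrX : irreducible_poly ('X : {poly F}) by rewrite -['X]subr0; exact: irredp_XsubC.
have sieve (t : seq {poly F}) : uniq t -> (forall r, r \in t -> irreducible_poly r /\ r \is monic) ->
    eqmodX N (\prod_(p <- t) (1 - 'X^((size p).-1)) * @siftsum F N [::]) (siftsum N t).
  elim: t => [|p t IHt] /=; first by rewrite big_nil mul1r => _ _; exact: eqmodX_refl.
  move=> /andP[pt ut] tP; rewrite big_cons -mulrA.
  have [irr_p mon_p] := tP p (mem_head _ _).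
  have tP' r : r \in t -> irreducible_poly r /\ r \is monic by move=> rt; apply: tP; rewrite inE rt orbT.
  apply: (eqmodX_trans (eqmodXMl _ (IHt ut tP'))); apply: eqmodX_sym.
  apply: siftsum_cons => // r rt; have [irr_r mon_r] := tP' r rt; split=> //.
  by apply: contraNneq pt => <-.
have us : uniq s.
  rewrite /= (map_inj_uniq primeX_inj) enum_uniq andbT; apply/mapP => -[i _ iX].
  by have := primeX_neqX i; rewrite -iX eqxx.
have sP r : r \in s -> irreducible_poly r /\ r \is monic.
  rewrite inE => /predU1P[->|/mapP[i _ ->]]; first by rewrite monicX.
  by split; [exact: primeX_irr | exact: primeX_monic].
have := sieve s us sP; rewrite big_cons size_polyX big_map big_enum /= expr1.
have -> : siftsum N s = 1.
  have sz1 : (size (1 : {poly F})%R <= N)%N by rewrite size_poly1 ltnW.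
  rewrite /siftsum (big_pred1 (NPoly sz1)) => [|f]; first by rewrite size_poly1.
  rewrite /sifted [RHS]/= -[RHS]val_eqE; apply/idP/eqP => [/andP[mf /allP sf]|fE]; last first.
    rewrite (_ : polyn f = 1) ?monic1 //; apply/andP; split=> //; apply/allP => p /sP[irr_p _]; rewrite dvdp1.
    by case: irr_p => + _; case: (size p) => [|[]].
  change (polyn f = 1); have [f1|f1] := leqP (size (polyn f)) 1.
    have f0 := monic_neq0 mf; rewrite (size1_polyC f1).
    by move/monicP: mf; rewrite {1}(size1_polyC f1) lead_coefC => ->.
  have [p [irr_p mon_p pf]] := irreducible_factor f1.
  have le_p : (size p <= N)%N.
    by apply: leq_trans (dvdp_leq (monic_neq0 mf) pf) (size_npoly f).
  have ps : p \in s.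
    rewrite inE; have [//|pX] := eqVneq p 'X.
    by have [i ->] := primeX_mem irr_p mon_p pX le_p; rewrite map_f // mem_enum.
  by have := sf p ps; rewrite pf.
rewrite siftsum_nil => H; rewrite -[X in eqmodX _ _ X]mul1r.
apply: eqmodX_inv H _; rewrite mulrC.
by have := geom_mod N #|F|%:Z%:P (ltn0Sn 0); rewrite expr1.
Qed.

End PrimeX.

(** * Euler products of polynomials in z and y *)

Section EulerProduct.
Variable N : nat.
Hypothesis N_gt1 : (1 < N)%N.
Implicit Types C K : {poly {poly int}}.

(** [K] is chosen before [F], which is the uniformity in q that the theorem asks for; [adams q 1]
    only evaluates z at q. *)
Definition euler_poly C := exists K, forall F : finFieldType,
  eqmodX N (\prod_(i : primeX F N) adams #|F| (size (primeX_poly i)).-1 C) (adams #|F| 1 K).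

Lemma euler_polyM C C' : euler_poly C -> euler_poly C' -> euler_poly (C * C').
Proof.
case=> K CK [K' CK']; exists (K * K') => F.
under eq_bigr do rewrite rmorphM; rewrite big_split rmorphM /=.
exact: eqmodXM (CK F) (CK' F).
Qed.

Lemma adams_dvd q D C k : (0 < D)%N -> (N <= k)%N -> eqmodX N (adams q D (C * 'X^k)) 0.
Proof.
move=> D0 le; rewrite rmorphM /= adamsXn -[0](mulr0 (adams q D C)).
by apply/eqmodXMl/eqmodXn/(leq_trans le); rewrite leq_pmull.
Qed.

Lemma primeX_deg_gt0 (F : finFieldType) (i : primeX F N) : (0 < (size (primeX_poly i)).-1)%N.
Proof. by case: (primeX_irr i); case: (size _) => [|[]]. Qed.

Lemma euler_poly_mod C C' k : (N <= k)%N -> euler_poly C -> euler_poly (C + C' * 'X^k).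
Proof.
move=> le [K CK]; exists K => F; apply: eqmodX_trans (CK F).
apply: eqmodX_prod => i; rewrite rmorphD /= -[X in eqmodX _ _ X]addr0.
by apply: eqmodXD; [exact: eqmodX_refl | exact/adams_dvd/le/primeX_deg_gt0].
Qed.

Let w j k : {poly {poly int}} := ('X^j)%:P * 'X^k.
Let geom j k := \sum_(i < N) w j k ^+ i.

Lemma adams_w q D j k : adams q D (w j k) = (q ^ (D * j))%N%:Z%:P * 'X^(D * k).
Proof.
by rewrite rmorphM /= adamsC adamsXn hornerXn -PoszXn -expnM.
Qed.

Lemma adams_geom q j k : (1 - adams q 1 (w j k)) * adams q 1 (geom j k)
  = (1 - (q ^ j)%N%:Z%:P * 'X^k) * \sum_(i < N) ((q ^ j)%N%:Z%:P * 'X^k) ^+ i.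
Proof.
rewrite rmorph_sum adams_w !mul1n; congr (_ * _).
by apply: eq_bigr => i _; rewrite rmorphXn /= adams_w !mul1n.
Qed.

(** Substitution of q^j y^k for y in [euler_base]: at degree D, the image of z^j y^k is (q^j
    y^k)^D. *)
Lemma euler_w (F : finFieldType) j k : (0 < k)%N -> eqmodX N
  ((1 - adams #|F| 1 (w j k)) * \prod_(i : primeX F N) adams #|F| (size (primeX_poly i)).-1 (1 - w j k))
  (1 - adams #|F| 1 (w j.+1 k)).
Proof.
move=> k0; have := eqmodX_comp (#|F| ^ j)%N%:Z%:P k0 (euler_base F N_gt1).
set c := (#|F| ^ j)%N%:Z%:P.
have wE D : adams #|F| D (w j k) = 'X^D \Po (c * 'X^k).
  by rewrite adams_w comp_Xn_poly exprMn -exprM -polyC_exp -PoszXn -expnM mulnC [(k * D)%N]mulnC.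
have wSE : adams #|F| 1 (w j.+1 k) = (#|F|%:Z%:P * 'X) \Po (c * 'X^k).
  by rewrite adams_w !mul1n comp_polyM comp_polyC comp_polyX mulrA -polyCM -PoszM expnS.
move=> H; under eq_bigr => i _ do rewrite rmorphB rmorph1 /= wE.
move: H; rewrite wE wSE expr1 comp_polyM !comp_polyB rmorph_prod comp_polyC /=.
by under eq_bigr => i _ do rewrite comp_polyB comp_polyC.
Qed.

(** The Euler product is (1 - z^(j+1) y^k) / (1 - z^j y^k), and [geom j k] is the inverse of the
    denominator modulo y^N. *)
Lemma euler_poly_w j k : (0 < k)%N -> euler_poly (1 - w j k).
Proof.
move=> k0; exists ((1 - w j.+1 k) * geom j k) => F.
rewrite rmorphM rmorphB rmorph1 /=.
apply: (eqmodX_inv (b := 1 - adams #|F| 1 (w j k))); first by rewrite mulrC; exact: euler_w.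
by rewrite adams_geom; apply: geom_mod.
Qed.

Lemma geom_w j k : exists C, (1 - w j k) * geom j k = 1 + C * 'X^(N * k).
Proof.
exists (- ('X^(j * N))%:P); rewrite /geom -opprB mulNr -subrX1 opprB.
by rewrite mulNr /w exprMn -exprM [(k * N)%N]mulnC -polyC_exp -exprM.
Qed.

Lemma euler_poly_geom j k : (0 < k)%N -> euler_poly (geom j k).
Proof.
move=> k0; exists ((1 - w j k) * geom j.+1 k) => F.
rewrite rmorphM rmorphB rmorph1 /=.
apply: (eqmodX_inv (b := 1 - adams #|F| 1 (w j.+1 k))); last first.
  by rewrite adams_geom; apply: geom_mod.
set G := \prod_i _; set Q := \prod_(i : primeX F N) adams #|F| (size (primeX_poly i)).-1 (1 - w j k).
(* [Q] is the inverse of [G] modulo y^N, factor by factor. *)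
apply: (@eqmodX_trans _ _ (G * ((1 - adams #|F| 1 (w j k)) * Q))).
  by apply/eqmodXMl/eqmodX_sym/euler_w.
rewrite mulrCA -[X in eqmodX _ _ X]mulr1; apply: eqmodXMl.
rewrite mulrC -big_split /=.
apply: (@eqmodX_trans _ _ (\prod_(i : primeX F N) 1)); last by rewrite big1_eq; apply: eqmodX_refl.
apply: eqmodX_prod => i; rewrite -rmorphM; have [C ->] := geom_w j k.
rewrite rmorphD rmorph1 -[X in eqmodX _ _ X]addr0.
apply: eqmodXD; first exact: eqmodX_refl.
by apply: adams_dvd; rewrite ?primeX_deg_gt0 ?leq_pmulr.
Qed.

(** Multiplying a polynomial 1 + c y^k + ... by [1 - w j k] or by its inverse [geom j k] changes [c]
    by -z^j or z^j and affects higher powers of y otherwise. So [c] is removed monomial by monomial,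
    then [k] increases until the remainder is a multiple of y^N. *)
Lemma euler_product C : C`_0 = 1 -> euler_poly C.
Proof.
suff H m k C' : (N - k <= m)%N -> (0 < k)%N -> euler_poly (1 + C' * 'X^k).
  move=> C0; have -> : C = 1 + (drop_poly 1 C) * 'X^1; last by apply: (H N); rewrite ?leq_subr.
  rewrite -[LHS](poly_take_drop 1); congr (_ + _).
  by apply/polyP => -[|i]; rewrite coef_take_poly coef1 /= ?C0.
elim: m k C' => [|m IHm] k C' le_m k0.
  apply: euler_poly_mod; first by rewrite -subn_eq0 -leqn0.
  by exists 1 => F; rewrite rmorph1 big1 => [|i _]; rewrite ?rmorph1 //; apply: eqmodX_refl.
have base C1 : euler_poly (1 + C1 * 'X^(k.+1)).
  by apply: IHm; rewrite // subnS -ltnS; case: (N - k)%N le_m.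
(* The higher terms [C1] are quantified because every correction of [c] alters them. *)
pose good (c : {poly int}) := forall C1, euler_poly (1 + c%:P * 'X^k + C1 * 'X^(k.+1)).
have XkE : 'X^k * 'X^k = 'X^(k.-1) * 'X^(k.+1) :> {poly {poly int}}.
  by rewrite -!exprD addnS -addSn prednK.
have goodD c j : good c -> good (c + 'X^j).
  move=> gc C1; set T := 1 + _ + _.
  have gT : euler_poly (T * (1 - w j k)).
    have -> : T * (1 - w j k) = 1 + c%:P * 'X^k
        + (C1 * (1 - w j k) - (c + 'X^j)%:P * ('X^j)%:P * 'X^(k.-1)) * 'X^(k.+1).
      rewrite mulrBl -[_ * 'X^(k.-1) * _]mulrA -XkE /T /w polyCD; ring.
    exact: gc.
  have [C2 gwE] := geom_w j k.
  have -> : T = T * (1 - w j k) * geom j k + (- T * C2) * 'X^(N * k).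
    by rewrite -mulrA gwE; ring.
  apply: euler_poly_mod; first by rewrite leq_pmulr.
  by apply: euler_polyM => //; apply: euler_poly_geom.
have goodB c j : good c -> good (c - 'X^j).
  move=> gc C1; set T := 1 + _ + _.
  (* The truncated series must contain its linear term, hence [N_gt1]. *)
  have [R gE] : exists R, geom j k = 1 + w j k + w j k ^+ 2 * R.
    rewrite /geom; case: (N) N_gt1 => [|[|N']] // _.
    rewrite !big_ord_recl /= expr0 expr1; exists (\sum_(i < N') w j k ^+ i).
    by rewrite mulr_sumr addrA; congr (_ + _); apply: eq_bigr => i _; rewrite -exprD.
  have gT : euler_poly (T * geom j k).
    have -> : T * geom j k = 1 + c%:P * 'X^k
        + (C1 * geom j k + ((c - 'X^j)%:P * ('X^j)%:P * (1 + w j k * R)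
            + ('X^j)%:P * ('X^j)%:P * R) * 'X^(k.-1)) * 'X^(k.+1).
      rewrite [X in _ = _ + X]mulrDl -[_ * 'X^(k.-1) * _]mulrA -XkE gE /T /w polyCB; ring.
    exact: gc.
  have [C2 gwE] := geom_w j k.
  have -> : T = T * geom j k * (1 - w j k) + (- T * C2) * 'X^(N * k).
    by rewrite -mulrA [geom j k * _]mulrC gwE; ring.
  apply: euler_poly_mod; first by rewrite leq_pmulr.
  by apply: euler_polyM => //; apply: euler_poly_w.
have goodZ c j (a : int) : good c -> good (c + a *: 'X^j).
  move=> gc; case: a => n.
    elim: n => [|n IHn]; first by rewrite scale0r addr0.
    by rewrite -addn1 PoszD scalerDl scale1r addrA; apply: goodD.
  rewrite NegzE; elim: n => [|n IHn]; first by rewrite scaleN1r; apply: goodB.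
  by rewrite -[n.+2]addn1 PoszD opprD scalerDl scaleN1r addrA; apply: goodB.
have good_all c : good c.
  rewrite -[c]coefK poly_def; elim: (size c) => [|r IHc].
    by rewrite big_ord0 => C1; rewrite mul0r addr0; apply: base.
  by rewrite big_ord_recr; apply: goodZ.
have -> : 1 + C' * 'X^k = 1 + (C'`_0)%:P * 'X^k + drop_poly 1 C' * 'X^(k.+1).
  rewrite -addrA -{1}(poly_take_drop 1 C') mulrDl -mulrA -exprD add1n; congr (_ + (_ * _ + _)).
  by apply/polyP => -[|i]; rewrite coef_take_poly coefC.
exact: good_all.
Qed.

End EulerProduct.

(** * Chain counts and isomorphism of modules of the same type *)

Section ChainCount.
Variables (F : finFieldType) (E : finLmodType {poly F}).
Implicit Types (W N : {set E}) (es : seq nat).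
Local Notation dim W := (trunc_log #|F| #|W|).

Fixpoint chaincount es W : nat :=
  if es is e :: es' then
    (\sum_(N : {set E} | [&& N \subset W, submod N & dim N == e]) chaincount es' N)%N
  else 1%N.

Fixpoint ischain es W (ws : seq {set E}) : bool :=
  match es, ws with
  | e :: es', w :: ws' => [&& w \subset W, submod w, dim w == e & ischain es' w ws']
  | [::], [::] => true
  | _, _ => false
  end.

Lemma card_ischain es W :
  #|[set t : (size es).-tuple {set E} | ischain es W t]| = chaincount es W.
Proof.
elim: es W => [|e es IHes] W /=.
  by rewrite (_ : [set t | _] = setT) ?cardsT ?card_tuple // -setP => t; rewrite !inE tuple0.
pose Q (w : {set E}) (t : (size es).-tuple {set E}) :=
  [&& w \subset W, submod w, dim w == e & ischain es w t].
transitivity #|[set t : (size es).+1.-tuple {set E} | Q (thead t) [tuple of behead t]]|.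
  by apply: eq_card => t; rewrite !inE {1}(tuple_eta t).
rewrite card_tupleS; under eq_bigr => t _ do rewrite -sum1_card.
rewrite (exchange_big_dep (fun N : {set E} => [&& N \subset W, submod N & dim N == e])) /=; last first.
  by move=> t N _; rewrite inE => /and4P[-> -> ->].
apply: eq_bigr => N /and3P[NW sN dN]; rewrite -IHes -sum1_card.
by apply: eq_bigl => t; rewrite !inE /Q NW sN dN.
Qed.

(* The exponents are encoded as the digits of a number written in base [b]. *)
Fixpoint kron b t : seq nat := if t is t'.+1 then (b ^ t')%N :: kron b t' else [::].
Fixpoint kronval b es : nat :=
  if es is e :: es' then (b ^ size es' * e + kronval b es')%N else 0%N.

Lemma kronval_lt b es : all (fun e => e < b)%N es -> (kronval b es < b ^ size es)%N.
Proof.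
elim: es => //= e es IHes /andP[eb /IHes lt]; rewrite expnSr.
apply: (@leq_trans (b ^ size es * e + b ^ size es)); first by rewrite ltn_add2l.
by rewrite -mulnSr leq_mul2l eb orbT.
Qed.

Lemma size_chainpoly b t W : (dim W < b)%N -> (size (chainpoly (kron b t) W) <= b ^ t)%N.
Proof.
elim: t W => [|t IHt] W ltW /=; first by rewrite size_poly1.
apply: leq_trans (size_sum _ _ _) _; apply/bigmax_leqP => N /andP[NW sN].
have ltN : (dim N < b)%N by apply: leq_ltn_trans ltW; rewrite leq_trunc_log // subset_leq_card.
have [->|Z0] := eqVneq (chainpoly (kron b t) N) 0; first by rewrite mulr0 size_poly0.
rewrite mulrC size_mulXn // expnSr.
apply: (@leq_trans (b ^ t * dim N + b ^ t)); first by rewrite leq_add2l IHt.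
by rewrite -mulnSr leq_mul2l ltN orbT.
Qed.

(** No carry occurs: a first member of dimension above [e] overshoots the exponent, and one of
    dimension below [e] leaves at least b^t to the t remaining digits, beyond the degree given by
    [size_chainpoly]. *)
Lemma coef_chainpoly b es W : all (fun e => e < b)%N es -> (dim W < b)%N ->
  (chainpoly (kron b (size es)) W)`_(kronval b es) = (chaincount es W)%:Z.
Proof.
elim: es W => [|e es IHes] W /=; first by rewrite coefC.
move=> /andP[eb esb] ltW; rewrite coef_sum (big_morph Posz PoszD (erefl _)).
rewrite [LHS](bigID (fun N : {set E} => dim N == e)) /= [X in _ + X]big1 ?addr0 => [|N].
  rewrite (eq_bigl (fun N : {set E} => [&& N \subset W, submod N & dim N == e])) => [|N];
    last by rewrite andbA.
  apply: eq_bigr => N /and3P[NW sN /eqP dN].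
  have ltN : (dim N < b)%N by rewrite dN.
  by rewrite coefXnM dN ltnNge leq_addr /= addKn IHes.
case/andP=> /andP[NW sN] dN; rewrite coefXnM; case: ltnP => // le.
have ltN : (dim N < b)%N by apply: leq_ltn_trans ltW; rewrite leq_trunc_log // subset_leq_card.
have b0 : (0 < b ^ size es)%N by rewrite expn_gt0 (leq_trans _ eb).
have ltdN : (dim N < e)%N.
  rewrite ltn_neqAle dN /= -ltnS -(ltn_pmul2l b0).
  apply: leq_ltn_trans le _; rewrite mulnSr ltn_add2l; exact: kronval_lt.
rewrite nth_default // (leq_trans (size_chainpoly _ ltN)) //.
rewrite -addnBAC ?leq_pmul2l // ?(ltnW ltdN) //.
by rewrite -mulnBr (leq_trans _ (leq_addr _ _)) // leq_pmulr // subn_gt0.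
Qed.

End ChainCount.

Section Comb.
Variables (F : finFieldType).
Implicit Types (L : seq ({poly F} * nat)) (a b : seq {poly F}).

Fixpoint comb (E : finLmodType {poly F}) (t : seq E) a : E :=
  match t, a with v :: t', c :: a' => comb t' a' + c *: v | _, _ => 0 end.

Lemma gen_comb (E : finLmodType {poly F}) L (t : seq E) v : eldiv L -> adp setT L t ->
  v \in gen L t -> exists a : seq {poly F}, (size a == size L) && (comb t a == v).
Proof.
elim: L t v => [|[p k] L IHL] [|w t] //= v.
  by rewrite inE => _ _ /eqP->; exists [::]; rewrite /= eqxx.
move=> /andP[/and3P[/irreducibleP irr_p mon_p k_gt0] eL] /and4P[at_ _ /eqP pkw pk1w].
case/(addcP _ _ irr_p pkw) => n /(IHL _ _ eL at_)[a /andP[sa /eqP aE]] [c ->].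
by exists (c :: a); rewrite /= eqSS sa aE eqxx.
Qed.

Lemma comb_gen (E : finLmodType {poly F}) L (t : seq E) a : eldiv L -> adp setT L t -> comb t a \in gen L t.
Proof.
elim: L t a => [|[p k] L IHL] [|w t] //= a; first by rewrite inE; case: a.
move=> /andP[/and3P[/irreducibleP irr_p mon_p k_gt0] eL] /and4P[at_ _ /eqP pkw pk1w].
have [sN _ _ _] := adp_gen (submod_setT E) eL at_.
case: a => [|c a]; first by rewrite submod0 ?submod_addc.
by apply/(addcP _ _ irr_p pkw); exists (comb t a); [exact: IHL | exists c].
Qed.

(* The relations among the generators of an adapted tuple only depend on [L]. *)
Lemma comb_eq0 (E : finLmodType {poly F}) L (t : seq E) a : eldiv L -> adp setT L t -> size a = size L ->
  (comb t a == 0) = all2 (fun x c => x.1 ^+ x.2 %| c) L a.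
Proof.
elim: L t a => [|[p k] L IHL] [|w t] [|c a] //=; first by rewrite eqxx.
move=> /andP[/and3P[/irreducibleP irr_p mon_p k_gt0] eL] /and4P[at_ _ /eqP pkw pk1w] [sa].
have [sN _ _ _] := adp_gen (submod_setT E) eL at_.
rewrite -(IHL t) //; apply/eqP/andP => [c0|[/dvdpP[d ->] /eqP->]]; last first.
  by rewrite add0r -scalerA pkw scaler0.
have : c *: w \in gen L t.
  by rewrite -(addKr (comb t a) (c *: w)) c0 addr0 submodN ?comb_gen.
move/(cycle_dvd sN irr_p pkw pk1w) => dv; split=> //.
by move/dvdpP: dv c0 => [d ->]; rewrite -scalerA pkw scaler0 addr0 => ->.
Qed.

Definition addz a b := [seq x.1 + x.2 | x <- zip a b].

Lemma combD (E : finLmodType {poly F}) (t : seq E) a b : size a = size b ->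
  comb t (addz a b) = comb t a + comb t b.
Proof.
elim: t a b => [|v t IHt] [|c a] [|d b] //=; rewrite ?addr0 // => -[sab].
by rewrite IHt // scalerDl addrACA.
Qed.

Lemma combZ (E : finLmodType {poly F}) (t : seq E) a c : comb t (map ( *%R c) a) = c *: comb t a.
Proof.
elim: t a => [|v t IHt] [|d a] //=; rewrite ?scaler0 //.
by rewrite IHt scalerDr scalerA.
Qed.

(** Coordinates along an adapted tuple [t] of the first module are reused along one of the second.
    By [comb_eq0] both tuples satisfy the same relations, so the choice of coordinates is
    immaterial. *)
Lemma same_type_iso (E1 E2 : finLmodType {poly F}) L : eldiv L ->
    oftype L [set: E1] -> oftype L [set: E2] ->
  exists f : E1 -> E2, [/\ injective f, {morph f : x y / x + y} & forall c, {morph f : x / c *: x}].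
Proof.
move=> eL /existsP[t /andP[at_ /eqP gt]] /existsP[u /andP[au /eqP gu]].
have ex v : exists a : seq {poly F}, (size a == size L) && (comb t a == v).
  by apply: gen_comb => //; rewrite gt inE.
pose a v := xchoose (ex v).
have sa v : size (a v) = size L by have /andP[/eqP] := xchooseP (ex v).
have aE v : comb t (a v) = v by have /andP[_ /eqP] := xchooseP (ex v).
have comb0 b : size b = size L -> (comb t b == 0) = (comb u b == 0).
  by move=> sb; rewrite (comb_eq0 eL at_ sb) (comb_eq0 eL au sb).
have sN b : size (map ( *%R (-1)) b) = size b by rewrite size_map.
have sD b c : size b = size L -> size c = size L -> size (addz b c) = size L.
  by move=> sb sc; rewrite size_map size_zip sb sc minnn.
have comb_inj b c : size b = size L -> size c = size L ->
    (comb t b == comb t c) = (comb u b == comb u c).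
  move=> sb sc; have sNc : size (map ( *%R (-1)) c) = size L by rewrite sN.
  have := comb0 (addz b (map ( *%R (-1)) c)); rewrite sD // => /(_ erefl).
  by rewrite !combD ?sb ?sNc // !combZ !scaleN1r !subr_eq0.
exists (fun v => comb u (a v)); split.
- by move=> v w /eqP; rewrite -comb_inj // !aE => /eqP.
- move=> v w; apply/eqP; rewrite -combD ?sa // -comb_inj ?sD // combD ?sa // !aE.
  exact: eqxx.
- move=> c v; apply/eqP; rewrite -combZ -comb_inj ?size_map // combZ !aE.
  exact: eqxx.
Qed.

Lemma oftype_iso (E1 E2 : finLmodType {poly F}) (f : E1 -> E2) L : eldiv L ->
    injective f -> {morph f : x y / x + y} -> (forall c, {morph f : x / c *: x}) ->
    #|E1| = #|E2| ->
  oftype L [set: E1] -> oftype L [set: E2].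
Proof.
move=> eL f_inj fD fZ cE /existsP[t /andP[at_ /eqP gt]].
apply/existsP; exists [tuple of map f t]; rewrite /= adp_map // gen_map // gt /=.
by rewrite eqEcard subsetT cardsT -cE card_imset ?cardsT ?leqnn.
Qed.

End Comb.

(** * Flags and parabolic subgroups *)

(** A basis of a complement is prepended at each stage, so every member of the chain is spanned by a
    tail of [X], as [stdsub] is by the last basis vectors. *)
Lemma chain_basis (K : fieldType) (vT : vectType K) (V : {vspace vT}) (Ws : seq {vspace vT}) :
  path (fun U W => W <= U)%VS V Ws ->
  exists X, basis_of V X /\ forall W, W \in Ws -> basis_of W (drop (\dim V - \dim W) X).
Proof.
elim: Ws V => [|W Ws IHW] V /=; first by exists (vbasis V); split; [exact: vbasisP|].
move=> /andP[WV pW]; have [X [bX dX]] := IHW W pW.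
have sD : size (vbasis (V :\: W)%VS) = (\dim V - \dim W)%N.
  by rewrite size_tuple -(dimv_cap_compl V W) (capv_idPr WV) addKn.
have bD : basis_of V (vbasis (V :\: W)%VS ++ X).
  rewrite basisEdim size_cat sD -(size_basis (X := in_tuple X) bX) subnK ?dimvS // andbT.
  by rewrite span_cat (span_basis (vbasisP _)) (span_basis bX) addv_diff addvSl.
exists (vbasis (V :\: W)%VS ++ X); split=> // U; rewrite inE => /predU1P[->|UW].
  by rewrite -sD drop_size_cat.
have UleW : (\dim U <= \dim W)%N.
  apply: dimvS; have trans : transitive (fun A B : {vspace vT} => B <= A)%VS.
    by move=> A B C BA CA; apply: subv_trans CA BA.
  by have /allP/(_ _ UW) := order_path_min trans pW.
have WleV := dimvS WV.
rewrite -(subnK WleV) -addnBA // drop_cat sD ltnNge leq_addr /= addKn.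
exact: dX.
Qed.

Lemma card_zero_prefix (F : finFieldType) m a : (a <= m)%N ->
  #|[set v : 'rV[F]_m | [forall j : 'I_m, (j < a)%N ==> (v 0 j == 0)]]| = (#|F| ^ (m - a))%N.
Proof.
move=> le; have [b mE] : exists b, m = (a + b)%N by exists (m - a)%N; rewrite subnKC.
subst m => {le}; rewrite addKn -[b in RHS]mul1n -card_mx.
rewrite -(card_imset predT (_ : injective (fun u : 'rV[F]_b => row_mx (0 : 'rV_a) u))); last first.
  by move=> u w /eq_row_mx[].
apply: eq_card => v; rewrite inE; apply/forallP/imsetP => [v0|[u _ ->] j].
  exists (rsubmx v) => //; rewrite -[LHS]hsubmxK; congr row_mx; apply/rowP => j.
  by rewrite !mxE; have /implyP/(_ (ltn_ord j))/eqP := v0 (lshift b j).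
apply/implyP => ja; rewrite (_ : j = lshift b (Ordinal ja)) ?row_mxEl ?mxE //.
exact: val_inj.
Qed.

Section Flags.
Variables (F : finFieldType) (n' : nat).
Local Notation n := n'.+1.
Local Notation q := #|F|.
Local Notation V := 'rV[F]_n.

(* On row vectors, the elements of the parabolic stabilize the spans of the last [n - k]
   basis vectors, for [k] in [d]. *)
Definition stdsub e : {set V} := [set v : V | [forall j : 'I_n, (j < n - e)%N ==> (v 0 j == 0)]].

Lemma stdsubP e (v : V) : reflect (forall j : 'I_n, (j < n - e)%N -> v 0 j = 0) (v \in stdsub e).
Proof.
by rewrite inE; apply: (iffP forallP) => H j; [move/(implyP (H j))/eqP | apply/implyP => /H/eqP].
Qed.

Lemma card_stdsub e : (e <= n)%N -> #|stdsub e| = (q ^ e)%N.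
Proof.
move=> le_e.
by rewrite card_zero_prefix ?leq_subr // subKn.
Qed.

Lemma parabolic_std d (h : 'M[F]_n) : all (fun k => k <= n)%N d ->
  (h \in parabolic F n d) = (h \in unitmx) &&
    all (fun k => [forall v in stdsub (n - k), v *m h \in stdsub (n - k)]) d.
Proof.
move=> dn; rewrite inE; congr (_ && _); apply/forallP/allP => [H k dk|H r].
  apply/forall_inP => v /stdsubP v0; apply/stdsubP => j.
  rewrite subKn ?(allP dn) // => jk; rewrite !mxE big1 // => r _.
  have [rk|kr] := ltnP r k; first by rewrite v0 ?mul0r // subKn ?(allP dn).
  have hd : has (fun k => (j < k)%N && (k <= r)%N) d by apply/hasP; exists k => //; rewrite jk.
  by have /forallP/(_ j)/implyP/(_ hd)/eqP-> := H r; rewrite mulr0.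
apply/forallP => j; apply/implyP => /hasP[k dk /andP[jk kr]].
have /forall_inP/(_ (delta_mx 0 r)) := H k dk.
have st : delta_mx 0 r \in stdsub (n - k).
  apply/stdsubP => i; rewrite subKn ?(allP dn) // => ik.
  by rewrite mxE eqxx /= (_ : i == r = false) // -val_eqE ltn_eqF // (leq_trans ik).
move/(_ st)/stdsubP/(_ j); rewrite subKn ?(allP dn) // -rowE mxE => -> //.
Qed.


Local Notation gT := {unit 'M[F]_n}.
Implicit Types x y z h : gT.

Definition parab_unit d : {set gT} := [set y : gT | val y \in parabolic F n d].

Definition stdim e y : {set V} := [set v *m val y | v in stdsub e].

Lemma unit_mulK y (v : V) : v *m val y *m val y^-1%g = v.
Proof. by rewrite -mulmxA -[val y *m _]/(val (y * y^-1)%g) mulgV mulmx1. Qed.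
Lemma unit_mulVK y (v : V) : v *m val y^-1%g *m val y = v.
Proof. by rewrite -mulmxA -[val y^-1%g *m _]/(val (y^-1 * y)%g) mulVg mulmx1. Qed.

Lemma mem_stdim e y v : (v \in stdim e y) = (v *m val y^-1%g \in stdsub e).
Proof.
apply/imsetP/idP => [[u su ->]|sv]; first by rewrite unit_mulK.
by exists (v *m val y^-1%g); rewrite ?unit_mulVK.
Qed.

Lemma card_stdim e y : (e <= n)%N -> #|stdim e y| = (q ^ e)%N.
Proof.
move=> le_e; rewrite card_imset ?card_stdsub //.
exact: (can_inj (g := mulmx^~ (val y^-1%g)) (unit_mulK y)).
Qed.

Lemma mem_parab_unit d h : all (fun k => k <= n)%N d ->
  (h \in parab_unit d) = all (fun e => [forall v in stdsub e, v *m val h \in stdsub e]) (map (subn n) d).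
Proof. by move=> dn; rewrite inE parabolic_std // (valP h) /= all_map. Qed.

Lemma stdim_sub_eq e y z : (e <= n)%N ->
  (stdim e y == stdim e z) = [forall v in stdsub e, v *m val (y * z^-1)%g \in stdsub e].
Proof.
move=> le_e; rewrite eqEcard !card_stdim // leqnn andbT.
apply/subsetP/forall_inP => H v.
  move=> sv; rewrite -[val _]/(val y *m val z^-1%g) mulmxA -mem_stdim; apply: H.
  exact: imset_f.
case/imsetP=> u su ->; rewrite mem_stdim -mulmxA; exact: H.
Qed.

(** The parabolic is the stabilizer of the standard flag, so translates of that flag correspond to
    right cosets of it. *)
Lemma stdim_tuple_eq d y z : all (fun k => k <= n)%N d ->
  (map (stdim^~ y) (map (subn n) d) == map (stdim^~ z) (map (subn n) d))
    = ((y * z^-1)%g \in parab_unit d).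
Proof.
move=> dn; rewrite mem_parab_unit //; elim: d dn => //= k d IHd /andP[kn dn].
by rewrite eqseq_cons IHd // stdim_sub_eq ?leq_subr.
Qed.

Lemma parab_group_set d : all (fun k => k <= n)%N d -> group_set (parab_unit d).
Proof.
move=> dn; apply/group_setP; split=> [|y z].
  by rewrite -(mulgV (1%g : gT)) -stdim_tuple_eq.
rewrite !mem_parab_unit // => /allP Hy /allP Hz; apply/allP => e de.
apply/forall_inP => v sv; rewrite -[val _]/(val y *m val z) mulmxA.
by apply: (forall_inP (Hz e de)); apply: (forall_inP (Hy e de)).
Qed.

Section Stable.
Variable x : gT.
Local Notation E := (gmod (val x)).

Lemma submod_stdim e y :
  submod (stdim e y : {set E}) = [forall v in stdsub e, v *m val (y * x * y^-1)%g \in stdsub e].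
Proof.
have valE v : v *m val (y * x * y^-1)%g = v *m val y *m val x *m val y^-1%g.
  by rewrite !mulmxA.
apply/submodP/forall_inP => [[_ _ sZ] v sv|H].
  rewrite valE -mem_stdim.
  have := sZ 'X (v *m val y); rewrite gscaleE horner_mx_X; apply.
  exact: imset_f.
have std0 : 0 \in stdsub e by apply/stdsubP => j; rewrite mxE.
have stdD : {in stdsub e &, forall u v, u + v \in stdsub e}.
  by move=> u v /stdsubP su /stdsubP sv; apply/stdsubP => j je; rewrite mxE su ?sv ?addr0.
have stdZ c : {in stdsub e, forall u, c *: u \in stdsub e}.
  by move=> u /stdsubP su; apply/stdsubP => j je; rewrite mxE su ?mulr0.
have sD : {in stdim e y &, forall u v, u + v \in stdim e y}.
  by move=> u v; rewrite !mem_stdim mulmxDl; apply: stdD.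
split=> //; first by rewrite mem_stdim mul0mx.
elim/poly_ind => [|a c IHa] v sv; first by rewrite scale0r mem_stdim mul0mx.
rewrite scalerDl -scalerA; apply: sD.
  apply: IHa; rewrite gscaleE horner_mx_X mem_stdim.
  by move: sv; rewrite mem_stdim => /H; rewrite valE unit_mulVK.
rewrite gscaleE horner_mx_C mul_mx_scalar mem_stdim -scalemxAl.
by apply: stdZ; rewrite -mem_stdim.
Qed.

Lemma stdsub_leq e e' : (e <= e')%N -> stdsub e \subset stdsub e'.
Proof.
move=> le; apply/subsetP => v /stdsubP sv; apply/stdsubP => j je.
by apply: sv; apply: leq_trans je _; rewrite leq_sub2l.
Qed.

Lemma ischain_stdim e0 es y : path geq e0 es -> (e0 <= n)%N ->
  ischain es (stdim e0 y : {set E}) (map (stdim^~ y) es)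
    = all (fun e => [forall v in stdsub e, v *m val (y * x * y^-1)%g \in stdsub e]) es.
Proof.
elim: es e0 => //= e es IHes e0 /andP[/= le pes] le0.
rewrite IHes ?(leq_trans le) // submod_stdim imsetS ?stdsub_leq //=.
by rewrite (card_stdim y (leq_trans le le0)) trunc_expnK ?card_finNzRing_gt1 // eqxx.
Qed.

(** Transitivity of GL_n on flags of given dimensions: the rows of [y] form a basis adapted to the
    chain. *)
Lemma ischain_surj es (ts : seq {set E}) : all (fun e => e <= n)%N es ->
  ischain es setT ts -> exists y, ts = map (stdim^~ y) es.
Proof.
move=> les ch; pose vs (w : {set E}) : {vspace V} := <<enum w>>%VS.
have mem_vs w (v : V) : submod w -> (v \in vs w) = (v \in w).
  move=> sw; apply/idP/idP => [/(coord_span (X := in_tuple (enum w))) -> /=|vw]; last first.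
    by apply: memv_span; rewrite mem_enum.
  elim/big_ind: _ => [|u u' uw u'w|i _]; first exact: submod0.
    exact: (submodD sw uw u'w).
  have iw : (enum w)`_i \in w by rewrite -mem_enum mem_nth.
  have := submodZ (coord (in_tuple (enum w)) i v)%:P sw iw.
  by rewrite gscaleE horner_mx_C mul_mx_scalar.
have sub_vs w w' : submod w -> submod w' -> w \subset w' -> (vs w <= vs w')%VS.
  by move=> sw sw' /subsetP ww'; apply/subvP => v; rewrite !mem_vs //; apply: ww'.
have vsT : vs setT = fullv.
  by apply/vspaceP => v; rewrite mem_vs ?submod_setT // inE memvf.
have chP W es' ts' : submod W -> ischain es' W ts' ->
    path (fun U U' => U' <= U)%VS (vs W) (map vs ts') /\ all (@submod _ E) ts'.
  elim: es' W ts' => [|e es' IHes] W [|w ts'] //= sW /and4P[wW sw _ /(IHes _ _ sw)[-> ->]].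
  by rewrite sub_vs ?sw.
have [pT sT] := chP _ _ _ (submod_setT _) ch; rewrite vsT in pT.
have [X [bX dX]] := chain_basis pT.
have dimV : \dim (fullv : {vspace V}) = n by rewrite dimvf /dim /= mul1n.
have szX : size X = n by rewrite -(size_basis (X := in_tuple X) bX).
pose ym : 'M[F]_n := \matrix_(i < n) (X`_i : 'rV_n).
have ymE (u : V) : u *m ym = \sum_i u 0 i *: X`_i.
  by rewrite mulmx_sum_row; apply: eq_bigr => i _; rewrite rowK.
have yU : ym \in unitmx.
  rewrite -row_full_unit -sub1mx; apply/row_subP => i; apply/submxP.
  have : row i 1%:M \in <<X>>%VS by rewrite (span_basis bX) memvf.
  rewrite -[X]/(tval (in_tuple X)) => /coord_span ->.
  exists (\row_(j < n) coord (in_tuple X) (cast_ord (esym szX) j) (row i 1%:M)).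
  rewrite ymE (reindex (cast_ord (esym szX))) /=; last first.
    by apply: onW_bij; exists (cast_ord szX) => j; rewrite ?cast_ordK ?cast_ordKV.
  by apply: eq_bigr => j _; rewrite mxE.
pose y : gT := FinRing.unit _ yU.
have stE w : w \in ts -> stdim (\dim (vs w)) y = w.
  move=> wt; have sw := allP sT _ wt; set m := \dim (vs w).
  have m_le : (m <= n)%N by rewrite -dimV dimvS // subvf.
  have bw : basis_of (vs w) (drop (n - m) X) by have := dX _ (map_f vs wt); rewrite dimV.
  have szd : size (drop (n - m) X) = m by rewrite size_drop szX subKn.
  apply/eqP; rewrite eqEcard card_stdim //; apply/andP; split.
    apply/subsetP => _ /imsetP[u /stdsubP su ->]; rewrite -mem_vs // ymE.
    apply: memv_suml => j _; have [jm|mj] := ltnP j (n - m); first by rewrite su ?scale0r ?mem0v.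
    apply/memvZ/(basis_mem bw); rewrite -(subnKC mj) -nth_drop mem_nth // szd.
    by rewrite ltn_subLR // subnK.
  pose f (c : 'rV[F]_m) : V := \sum_(i < m) c 0 i *: (drop (n - m) X)`_i.
  have sub : w \subset [set f c | c : 'rV[F]_m].
    apply/subsetP => v vw; have : v \in vs w by rewrite mem_vs.
    rewrite -(span_basis bw) -[drop _ _]/(tval (in_tuple (drop (n - m) X))) => /coord_span vE.
    apply/imsetP; exists (\row_(j < m) coord (in_tuple (drop (n - m) X)) (cast_ord (esym szd) j) v) => //.
    rewrite [LHS]vE /f (reindex (cast_ord (esym szd))) /=; last first.
      by apply: onW_bij; exists (cast_ord szd) => j; rewrite ?cast_ordK ?cast_ordKV.
    by apply: eq_bigr => j _; rewrite mxE.
  apply: leq_trans (subset_leq_card sub) _; apply: leq_trans (leq_imset_card _ _) _.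
  by rewrite card_mx mul1n.
exists y; have chD : forall W es' ts', ischain es' W ts' -> {subset ts' <= ts} ->
    ts' = map (stdim^~ y) es'.
  move=> W es'; elim: es' W => [|e es' IHes] W [|w ts'] //= /and4P[_ _ /eqP dw cw] sub.
  rewrite -(IHes _ _ cw) => [|z zt]; last by apply: sub; rewrite inE zt orbT.
  have := stE w (sub _ (mem_head _ _)); set m := \dim _ => wE.
  have m_le : (m <= n)%N by rewrite -dimV dimvS // subvf.
  congr (_ :: _); rewrite -{1}wE; congr stdim.
  by rewrite -dw -wE card_stdim // trunc_expnK // card_finNzRing_gt1.
exact: chD ch _.
Qed.

(** The condition on [y] says that the translate by [y] of the standard flag is stable under [x],
    hence a chain of submodules; each such chain arises from exactly one right coset of the
    parabolic. *)
Lemma card_flags d : sorted ltn d -> all (fun k => k <= n)%N d ->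
  #|[set y | (y * x * y^-1)%g \in parab_unit d]|
    = (chaincount (map (subn n) d) [set: E] * #|parab_unit d|)%N.
Proof.
move=> sd dn; set es := map (subn n) d.
have les : all (fun e => e <= n)%N es by apply/allP => _ /mapP[k _ ->]; exact: leq_subr.
have pes : path geq n es.
  rewrite /es; case: d sd dn {es les} => //= k d pk /andP[kn dn]; rewrite leq_subr /=.
  elim: d k pk kn dn => //= l d IHd k /andP[kl pl] kn /andP[ln dn].
  by rewrite IHd // andbT leq_sub2l // ltnW.
have stT y : stdim n y = setT.
  by apply/eqP; rewrite eqEcard subsetT card_stdim // cardsT card_mx mul1n leqnn.
rewrite -card_ischain -sum_nat_const -[LHS]sum1_card.
rewrite (partition_big (fun y => [tuple of map (stdim^~ y) (in_tuple es)] : (size es).-tuple {set E})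
   [in [set t : (size es).-tuple {set E} | ischain es setT t]]) => [|y]; last first.
  by rewrite [y \in _]inE inE /= -(stT y) ischain_stdim // -mem_parab_unit.
apply: eq_bigr => t; rewrite inE => ch; rewrite sum1_card.
have [y0 tE] := ischain_surj les ch.
rewrite -[RHS](card_imset _ (mulIg y0)).
apply: eq_card => y; rewrite unfold_in /= inE; apply/andP/imsetP => [[_ /eqP/(congr1 val) /= yt]|].
  exists (y * y0^-1)%g; last by rewrite mulgKV.
  by rewrite -stdim_tuple_eq // -/es yt tE.
case=> h hP ->; have tE2 : map (stdim^~ (h * y0)%g) es = t.
  by rewrite tE; apply/eqP; rewrite stdim_tuple_eq // mulgK.
split; last by apply/eqP/val_inj.
by rewrite mem_parab_unit // -/es -(ischain_stdim _ pes) // stT tE2.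
Qed.

End Stable.

End Flags.

(** By Burnside, the left side is the sum of the orders of the centralizers of the [a] in [P]. The
    elements conjugating [repr c] to [a] form a coset of that centralizer if [c] is the class of
    [a], and there are none otherwise. *)
Lemma orbit_count_conj (gT : finGroupType) (P : {group gT}) :
  (#|[set (x ^: P)%g | x in [set: gT]]| * #|P|
    = \sum_(c in classes [set: gT]) #|[set y | (y * repr c * y^-1)%g \in P]|)%N.
Proof.
have actT : [acts P, on [set: gT] | 'J] by apply/actsP => a _ x; rewrite !inE.
have := Frobenius_Cauchy actT.
rewrite (eq_imset _ (fun x => orbitJ P x)) => <-.
transitivity (\sum_(a in P) \sum_(c in classes [set: gT]) #|[set y | (y * repr c * y^-1)%g == a]|)%N.
  apply: eq_bigr => a Pa; rewrite setTI afixJ cent_set1.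
  have /imsetP[z _ rE] := mem_repr a (class_refl [set: gT] a).
  have conjE (y r : gT) : (y * r * y^-1 = r ^ y^-1)%g by rewrite conjgE invgK mulgA.
  rewrite (bigD1 (a ^: setT)%g) ?mem_classes ?inE //= [X in (_ + X)%N]big1 ?addn0.
    rewrite -(card_imset _ (mulIg z)); apply: eq_card => y; rewrite inE rE conjE -conjgM.
    apply/imsetP/eqP => [[w /cent1P wa ->]|yE].
      by rewrite invMg mulKVg -conjE wa mulgK.
    exists (y * z^-1)%g; last by rewrite mulgKV.
    rewrite -groupV invMg invgK; apply/cent1P.
    by rewrite /commute [RHS]conjgC yE.
  move=> c /andP[/imsetP[b _ cE] ca]; apply: eq_card0 => y; rewrite inE.
  apply: contraNF ca => /eqP yE; rewrite cE; apply/eqP/esym/class_eqP.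
  have /imsetP[w _ bE] := mem_repr b (class_refl [set: gT] b).
  by rewrite -yE cE bE conjE -conjgM; apply/imsetP; exists (w * y^-1)%g; rewrite ?inE.
rewrite exchange_big /=; apply: eq_bigr => c _.
rewrite -[RHS]sum1_card [RHS](partition_big (fun y => y * repr c * y^-1)%g [in P]) /= => [|y];
  last by rewrite inE.
apply: eq_bigr => a Pa; rewrite -sum1_card; apply: eq_bigl => y; rewrite !inE.
by apply/idP/andP => [/eqP->|[]//]; rewrite Pa eqxx.
Qed.

Lemma num_parabolic_classesE (F : finFieldType) n' d (P : {group {unit 'M[F]_n'.+1}}) :
  P :=: parab_unit F n' d ->
  num_parabolic_classes F n'.+1 d =
    #|[set (x ^: P)%g | x in [set: {unit 'M[F]_n'.+1}]]|.
Proof.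
move=> PE; rewrite /num_parabolic_classes.
pose f (S : {set {unit 'M[F]_n'.+1}}) : {set 'M[F]_n'.+1} := [set val y | y in S].
have f_inj : injective f by apply: imset_inj; exact: val_inj.
rewrite -[RHS](card_imset _ f_inj) -imset_comp.
have orbE (x : {unit 'M[F]_n'.+1}) : conj_orbit (parabolic F n'.+1 d) (val x) = f (x ^: P)%g.
  apply/setP => z; apply/imsetP/imsetP => [[g gP ->]|[_ /imsetP[h hP ->] ->]].
    have gU : g \in unitmx by move: gP; rewrite inE => /andP[].
    pose h : {unit 'M[F]_n'.+1} := FinRing.unit _ gU.
    have hP : h \in P by rewrite PE inE.
    (* [x ^ h] means h^-1 x h, so conjugation by [g] is the right action of the inverse. *)
    exists (x ^ h^-1)%g; first by apply: imset_f; rewrite groupV.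
    by rewrite /conjg invgK mulgA.
  exists (val h^-1%g); first by have := groupVr hP; rewrite {1}PE inE.
  have -> : invmx (val h^-1%g) = val h by rewrite -[LHS]/(val (h^-1^-1)%g) invgK.
  by rewrite /conjg mulgA.
congr #|pred_of_set _|; apply/setP => S; apply/imsetP/imsetP => [[x xU ->]|[x _ ->]].
  have xU' : x \in unitmx by rewrite inE in xU.
  by exists (FinRing.unit _ xU'); [rewrite in_setT | exact: (orbE (FinRing.unit _ xU'))].
by exists (val x); [rewrite inE (valP x) | rewrite /= -orbE].
Qed.

(** * Conjugacy classes and types *)

Lemma parts_nil n : parts ([ffun=> ord0] : ltype n) = [::].
Proof.
rewrite /parts (_ : [seq _ | _ <- _] = nseq (size (enum 'I_n)) [::]); last first.
  by elim: (enum _) => //= k s ->; rewrite ffunE.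
by elim: (size _).
Qed.

Lemma sumn_parts_eq0 n (a : ltype n) : (sumn (parts a) == 0)%N = (a == [ffun=> ord0]).
Proof.
apply/idP/eqP => [/eqP s0|->]; last by rewrite parts_nil.
apply: parts_inj => j; rewrite parts_nil.
by case: (parts a) (parts_gt0 a) s0 => //= k l /andP[]; case: k.
Qed.

Lemma hall0 l : hall [::] l = 1.
Proof.
by rewrite /hall /= Pdiv.RingMonic.rdivpp ?monic1.
Qed.

Lemma coef0_type_sum n (b : nat) (c f : ltype n -> {poly {poly int}}) : (0 < b)%N ->
  (\sum_a c a * 'X^(b * sumn (parts a)) * f a)`_0 = (c [ffun=> ord0])`_0 * (f [ffun=> ord0])`_0.
Proof.
move=> b0; rewrite coef_sum (bigD1 [ffun=> ord0]) //= big1 ?addr0 => [|a a0].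
  have -> : sumn (parts ([ffun=> ord0] : ltype n)) = 0%N by apply/eqP; rewrite sumn_parts_eq0.
  by rewrite muln0 mulr1 coef0M.
rewrite !coef0M coefXn eq_sym muln_eq0 gtn_eqF //= sumn_parts_eq0 (negPf a0).
by rewrite mulr0 mul0r.
Qed.

Lemma locpoly_coef0 n bs (a : ltype n) : all (fun b => 0 < b)%N bs -> (locpoly bs a)`_0 = 1.
Proof.
elim: bs a => [|b bs IHb] a /=; first by rewrite coef1.
move=> /andP[b0 bs0]; rewrite coef0_type_sum // IHb // mulr1 coefC /=.
by rewrite parts_nil hall0.
Qed.

Section Assembly.
Variables (F : finFieldType) (n' N : nat).
Local Notation n := n'.+1.
Hypothesis ltnN : (n < N)%N.
Local Notation q := #|F|.
Local Notation I := (primeX F N).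
Local Notation P := (@primeX_poly F N).
Local Notation gT := {unit 'M[F]_n}.
Implicit Types (x y : gT) (m : {ffun I -> ltype n}).

Let Pinj : injective P := @primeX_inj F N.
Let Pirr := @primeX_irr F N.
Let Pmon := @primeX_monic F N.
Let wt m := (\sum_i (size (P i)).-1 * sumn (parts (m i)))%N.
Let tot x := [set: gmod (val x)].

Let card_tot x : #|tot x| = (q ^ n)%N.
Proof. by rewrite cardsT card_mx mul1n. Qed.

(** A polynomial missing from [P] is either ['X], which acts injectively as [x] is invertible, or of
    degree at least [N]; in the latter case a nonzero vector that it kills would generate more than
    q^n vectors. *)
Lemma supported_tot x : supported P (tot x).
Proof.
move=> p v irr_p mon_p pP _ pv; have [pX|pX] := eqVneq p 'X.
  move: pv; rewrite pX gscaleE horner_mx_X => vx; by rewrite -(unit_mulK x v) vx mul0mx.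
have ltNp : (N < size p)%N.
  by rewrite ltnNge; apply/negP => /(primeX_mem irr_p mon_p pX)[i pE]; have := pP i; rewrite pE eqxx.
apply: contraTeq ltnN => v0; rewrite -leqNgt.
have pv1 : p ^+ 1 *: v = 0 by rewrite expr1.
have pv0 : p ^+ 1.-1 *: v \notin [set 0] by rewrite expr0 scale1r inE.
have := card_addc (submod_set0 _) irr_p pv1 pv0; rewrite cards1 mul1n muln1 => cE.
have : (q ^ (size p).-1 <= q ^ n)%N by rewrite -cE -(card_tot x) subset_leq_card ?subsetT.
rewrite leq_exp2l ?card_finNzRing_gt1 // => le.
rewrite (leq_trans _ le) // -ltnS prednK //; exact: leq_trans ltNp.
Qed.

Lemma exists_tp x : exists m, oftype (fcanon P m) (tot x).
Proof.
by apply: (type_exists Pinj Pirr Pmon (submod_setT _) (supported_tot (x := x))); rewrite card_tot.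
Qed.
Definition tp x := xchoose (exists_tp x).
Let tpP x : oftype (fcanon P (tp x)) (tot x) := xchooseP (exists_tp x).

Let eldivm m : eldiv (fcanon P m) := eldiv_fcanon Pirr Pmon m.

Lemma oftype_tp x m : oftype (fcanon P m) (tot x) -> m = tp x.
Proof.
move=> om; have [_ _ t1] := oftypeP (eldivm m) om.
have [_ _ t2] := oftypeP (eldivm _) (tpP x).
exact: (type_uniq Pinj Pirr Pmon t1 t2).
Qed.

Lemma wt_tp x : wt (tp x) = n.
Proof.
have [_ + _] := oftypeP (eldivm _) (tpP x).
rewrite card_tot weight_canon => /eqP; rewrite eqn_exp2l ?card_finNzRing_gt1 // => /eqP.
by [].
Qed.

(** Right multiplication by [y] is an isomorphism from the module of [x] to that of [x ^ y]. *)
Lemma tp_conj x y : tp (x ^ y) = tp x.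
Proof.
apply/esym/oftype_tp; pose f (v : gmod (val x)) : gmod (val (x ^ y)%g) := v *m val y.
apply: (@oftype_iso _ _ _ f) (tpP x) => //.
- exact: (can_inj (g := mulmx^~ (val y^-1%g)) (unit_mulK y)).
- by move=> u v; exact: mulmxDl.
move=> c v; rewrite /f !gscaleE -!mulmxA; congr (v *m _).
have xyE : val y *m val (x ^ y)%g = val x *m val y.
  by rewrite -[LHS]/(val (y * x ^ y)%g) -conjgC.
elim/poly_ind: c => [|c a IHc]; first by rewrite !rmorph0 mul0mx mulmx0.
rewrite !rmorphD !rmorphM /= !horner_mx_X !horner_mx_C mulmxDl mulmxDr.
rewrite mul_scalar_mx mul_mx_scalar; congr (_ + _).
by rewrite -[_ * _]/(_ *m _) -mulmxA -xyE !mulmxA IHc.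
Qed.

(** The isomorphism of the two modules is linear over F, and its matrix intertwines [x] and [x']
    because it commutes with ['X]. *)
Lemma tp_eq_conj x x' : tp x = tp x' -> x' \in (x ^: [set: gT])%g.
Proof.
move=> txx'; have ox' := tpP x'; rewrite -txx' in ox'.
have [f [f_inj fD fZ]] := same_type_iso (eldivm _) (tpP x) ox'.
have f_lin : linear (f : 'rV[F]_n -> 'rV[F]_n).
  move=> c u v; have := fD (c%:P *: (u : gmod (val x))) v; rewrite fZ !gscaleE !horner_mx_C.
  by rewrite !mul_mx_scalar.
pose fL : {linear 'rV[F]_n -> 'rV[F]_n} :=
  HB.pack (f : 'rV[F]_n -> 'rV[F]_n) (GRing.isLinear.Build F _ _ _ _ f_lin).
have fE (v : 'rV[F]_n) : v *m lin1_mx fL = f v by rewrite mul_rV_lin1.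
have yU : lin1_mx fL \in unitmx.
  rewrite -row_free_unit -kermx_eq0; apply/eqP/row_matrixP => i.
  rewrite row0; apply: f_inj; rewrite -fE -row_mul mulmx_ker row0.
  by apply/esym; rewrite -fE mul0mx.
pose y : gT := FinRing.unit _ yU.
have xyE : (x * y = y * x')%g.
  apply: val_inj; rewrite /=; apply/row_matrixP => i.
  rewrite -[val x * _]/(val x *m _) -[_ * val x']/(_ *m val x').
  rewrite !row_mul !rowE !fE; have := fZ 'X (delta_mx 0 i : gmod (val x)).
  by rewrite !gscaleE !horner_mx_X.
apply/imsetP; exists y; rewrite ?in_setT //.
by rewrite /conjg xyE mulKg.
Qed.

Lemma exists_wt m : wt m = n -> exists x, tp x = m.
Proof.
move=> wm; have Ln : fcanon P m != [::].
  apply: contra_eq_neq wm => L0; have : wt m = weight (fcanon P m) by rewrite weight_canon.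
  by rewrite L0 /weight big_nil => ->.
have [n1 [g [t [n1E at_]]]] := exists_adp (eldivm m) Ln.
have n1n : n1 = n' by move: n1E; rewrite weight_canon [X in _ = X -> _]wm => -[].
subst n1; have [sN _ cN tN] := adp_gen (submod_setT _) (eldivm m) at_.
have gT' : gen (fcanon P m) t = [set: gmod g].
  by apply/eqP; rewrite eqEcard subsetT cardsT cN -n1E card_mx mul1n leqnn.
(* [g] is invertible because ['X] is not among the [P i]: the type forbids vectors killed by
   ['X]. *)
have gU : g \in unitmx.
  rewrite -row_free_unit -kermx_eq0; apply/eqP/row_matrixP => i; rewrite row0.
  have tT : hastype [set: gmod g] (fcanon P m) by rewrite -gT'.
  have supT := hastype_supported (submod_setT _) tT.
  apply: (supT 'X) => //.
  - by rewrite -['X]subr0; exact: irredp_XsubC.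
  - exact: monicX.
  - by move=> j; rewrite eq_sym primeX_neqX.
  - by rewrite gscaleE horner_mx_X -row_mul mulmx_ker row0.
exists (FinRing.unit _ gU); apply/esym/oftype_tp; apply/existsP; exists t.
by rewrite at_; apply/eqP; exact: gT'.
Qed.

Lemma sum_classes_types (R : nmodType) (h : {ffun I -> ltype n} -> R) :
  \sum_(c in classes [set: gT]) h (tp (repr c)) = \sum_(m | wt m == n) h m.
Proof.
rewrite -(big_imset (h := fun c => tp (repr c)) h) /=; last first.
  move=> c c' /repr_classesP[_ cE] /repr_classesP[_ cE'] /tp_eq_conj cc'.
  by rewrite cE cE'; apply/esym/class_eqP.
apply: eq_bigl => m; apply/imsetP/eqP => [[c _ ->]|/exists_wt[x <-]]; first exact: wt_tp.
exists (x ^: [set: gT])%g; first by rewrite mem_classes ?in_setT.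
have /imsetP[y _ ->] := mem_repr x (class_refl [set: gT] x).
by rewrite tp_conj.
Qed.

End Assembly.

Lemma kron_gt0 b t : (0 < b)%N -> all (fun c => 0 < c)%N (kron b t).
Proof. by move=> b0; elim: t => //= t ->; rewrite expn_gt0 b0. Qed.

(** * The coefficient that counts the parabolic classes *)

Section Coefficient.
Variables (F : finFieldType) (n' : nat) (d : seq nat).
Local Notation n := n'.+1.
Local Notation q := #|F|.
Local Notation gT := {unit 'M[F]_n}.
Local Notation es := (map (subn n) d).
Local Notation B := n.+1.
Local Notation b0 := (B ^ size es)%N.
Local Notation N := (B ^ (size es).+1)%N.
Hypotheses (sorted_d : sorted ltn d) (le_d : all (fun k => k <= n)%N d).

Lemma num_parabolic_classes_chaincount :
  num_parabolic_classes F n d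
    = (\sum_(c in classes [set: gT]) chaincount es [set: gmod (val (repr c))])%N.
Proof.
pose P : {group gT} := Group (parab_group_set F le_d).
rewrite (num_parabolic_classesE (P := P)) //.
have P0 : (0 < #|P|)%N := cardG_gt0 P.
apply/eqP; rewrite -(eqn_pmul2r P0) orbit_count_conj big_distrl /=; apply/eqP.
by apply: eq_bigr => c _; rewrite -card_flags.
Qed.

Local Notation P := (@primeX_poly F N).
Local Notation deg i := (size (P i)).-1.

Let ltnN : (n < N)%N.
Proof. by rewrite (@leq_trans B) // -{1}[B]expn1 leq_exp2l. Qed.

Let es_lt : all (fun e => e < B)%N es.
Proof. by rewrite all_map; apply/allP => k _ /=; rewrite ltnS leq_subr. Qed.

(** The leading digit of the index is n, the dimension of the whole module, and the others are the
    dimensions n - d_i of the chain. Families of weight n correspond to conjugacy classes; those of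
    larger weight overshoot the index. *)
Lemma coef_type_sum :
  (\prod_(i : primeX F N) adams q (deg i)
      (\sum_(a : ltype n) 'X^(b0 * sumn (parts a)) * locpoly (kron B (size es)) a))
    `_(b0 * n + kronval B es)
  = (num_parabolic_classes F n d)%:Z.
Proof.
have Pirr := @primeX_irr F N; have Pmon := @primeX_monic F N.
have Pinj := @primeX_inj F N.
under eq_bigr => i _ do rewrite rmorph_sum.
rewrite bigA_distr_bigA /= coef_sum.
pose wt (m : {ffun primeX F N -> ltype n}) := (\sum_i deg i * sumn (parts (m i)))%N.
pose Z (m : {ffun primeX F N -> ltype n}) :=
  \prod_(i : primeX F N) adams q (deg i) (locpoly (kron B (size es)) (m i)).
have kvlt := kronval_lt es_lt.
transitivity (\sum_(m | wt m == n) (Z m)`_(kronval B es)).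
  rewrite [RHS]big_mkcond /=; apply: eq_bigr => m _.
  under eq_bigr => i _ do rewrite rmorphM /= adamsXn mulnCA.
  rewrite big_split /= -expr_sum -big_distrr /= -/(wt m) -/(Z m) coefXnM.
  have b0_gt0 : (0 < b0)%N by rewrite expn_gt0.
  have eldivm := eldiv_fcanon Pirr Pmon m.
  case: (ltngtP (wt m) n) => [lt|gt|->].
  (* A family of weight below n belongs to no matrix of size n; realizing it in some other module
     identifies [Z m] with a chain polynomial and so bounds its degree. *)
  - have [E [W oW]] := exists_oftype eldivm; have [sW cW tW] := oftypeP eldivm oW.
    have cW' : #|W| = (q ^ wt m)%N by rewrite cW weight_canon.
    have le_W : (#|W| <= q ^ n)%N by rewrite cW' leq_exp2l ?card_finNzRing_gt1 // ltnW.
    have ZE : Z m = chainpoly (kron B (size es)) W by rewrite (chainpoly_prod Pinj Pirr Pmon _ sW le_W tW).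
    case: ltnP => // _; rewrite nth_default // ZE.
    apply: leq_trans (size_chainpoly _ _) _.
      by rewrite cW' trunc_expnK ?card_finNzRing_gt1 // ltnS ltnW.
    rewrite -addnBAC ?leq_pmul2l ?(ltnW lt) // -mulnBr.
    by rewrite (leq_trans _ (leq_addr _ _)) // leq_pmulr // subn_gt0.
  - rewrite ifT //; apply: (@leq_trans (b0 * n + b0)); first by rewrite ltn_add2l.
    by rewrite -mulnSr leq_pmul2l.
  - by rewrite ltnNge leq_addr /= addKn.
rewrite -(sum_classes_types ltnN (fun m => (Z m)`_(kronval B es))).
rewrite num_parabolic_classes_chaincount (big_morph Posz PoszD (erefl _)).
apply: eq_bigr => c _; have eldivm := eldiv_fcanon Pirr Pmon (tp ltnN (repr c)).
have cT : #|[set: gmod (val (repr c))]| = (q ^ n)%N by rewrite cardsT card_mx mul1n.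
have [_ _ tT] := oftypeP eldivm (xchooseP (exists_tp ltnN (repr c))).
rewrite /Z -(chainpoly_prod Pinj Pirr Pmon _ (submod_setT _) _ tT) ?cT //.
by apply: coef_chainpoly; rewrite // cT trunc_expnK ?card_finNzRing_gt1.
Qed.

End Coefficient.

Theorem theorem1p1 (n : nat) (d : seq nat) :
  (0 < n)%N -> dimvec n d ->
  exists k : {poly int},
    forall F : finFieldType,
      (num_parabolic_classes F n d)%:Z = k.[(#|F|)%:Z].
Proof.
case: n => // n' _ /and4P[d_neq0 d_gt0 sorted_d /eqP last_d].
have le_d : all (fun k => k <= n'.+1)%N d.
  rewrite -last_d; case: d sorted_d {d_neq0 d_gt0 last_d} => //= k d.
  elim/last_ind: d => [|d l IHd] /=; first by rewrite leqnn.
  rewrite rcons_path last_rcons all_rcons leqnn /= => /andP[/IHd /= /andP[kl dl] ltl].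
  rewrite (leq_trans kl) ?(ltnW ltl) //=.
  by apply: sub_all dl => i /leq_trans; apply; apply: ltnW.
(* All digits are dimensions at most n, hence below [B]. An index with s + 1 digits is then below
   [B ^ s.+1], so truncating there keeps its coefficient. *)
set s := size (map (subn n'.+1) d); set B := n'.+2.
have N_gt1 : (1 < B ^ s.+1)%N by rewrite (@leq_trans B) // -{1}[B]expn1 leq_exp2l.
have [|K KE] := @euler_product _ N_gt1
   (\sum_(a : ltype n'.+1) 'X^(B ^ s * sumn (parts a)) * locpoly (kron B s) a).
  under eq_bigr => a _ do rewrite -[X in X * _]mul1r.
  rewrite coef0_type_sum ?expn_gt0 // locpoly_coef0 ?kron_gt0 //.
  by rewrite mulr1 coef1.
exists K`_(B ^ s * n'.+1 + kronval B (map (subn n'.+1) d)) => F.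
rewrite -(coef_type_sum F sorted_d le_d) (eqmodX_coef (KE F)) => [|].
  by rewrite /adams expr1 comp_polyXr coef_map /= /horner_eval expn1.
apply: (@leq_trans (B ^ s * n'.+1 + B ^ s)); last by rewrite -mulnSr expnSr.
rewrite ltn_add2l; apply: kronval_lt; rewrite all_map; apply/allP => k _ /=.
by rewrite ltnS leq_subr.
Qed.
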